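(* Let $\boldsymbol{A}\in\mathcal{DM}_{\rm loc}(\Omega)$ and let $\lambda:\Omega\to[0,1]$ be a Borel function. Then for every sequence $(u_n)_n\subset X^{\boldsymbol{A},\lambda}_{\rm loc}(\Omega)$ and every $u\in X^{\boldsymbol{A},\lambda}_{\rm loc}(\Omega)$ such that $(u_n)_n$ $(\boldsymbol{A},\lambda)$-converges to $u$, it holds $$\langle(\boldsymbol{A},Du)_\lambda,\varphi\rangle=\lim_{n\to+\infty}\langle(\boldsymbol{A},Du_n)_\lambda,\varphi\rangle\qquad\forall\varphi\in C_c^1(\Omega)$$ in the sense of distributions. In addition, if $u,u_n\in BV^{\boldsymbol{A},\lambda}(\Omega)$ for all $n\in\mathbb{N}$, then $$|(\boldsymbol{A},Du)_\lambda|(\Omega)\le\liminf_{n\to+\infty}|(\boldsymbol{A},Du_n)_\lambda|(\Omega),$$ and, if moreover $\sup_{n\in\mathbb{N}}|(\boldsymbol{A},Du_n)_\lambda|(\Omega)<+\infty$, then $(\boldsymbol{A},Du_n)_\lambda\rightharpoonup(\boldsymbol{A},Du)_\lambda$ in $\mathcal{M}(\Omega)$.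
   Context: $\Omega\subset\mathbb{R}^N$ is a nonempty open set; $\mathscr{L}^N$ is Lebesgue measure. $\mathcal{M}(\Omega)$, $\mathcal{M}_{\rm loc}(\Omega)$ are the finite, respectively locally finite, (signed) Radon measures on $\Omega$, $\mathcal{M}_{\rm loc}(\Omega;\mathbb{R}^N)$ the vector-valued version; $|\mu|$ is the total variation. $\mu_k\rightharpoonup\mu$ in $\mathcal{M}(\Omega)$ means $\int\varphi\,d\mu_k\to\int\varphi\,d\mu$ for all $\varphi\in C_c(\Omega)$. $\mathscr{B}(\Omega)$ is the set of Borel functions $u:\Omega\to\mathbb{R}$ modulo $\mathscr{L}^N$-a.e. equality. Density: $D(E;x):=\lim_{r\to0^+}\mathscr{L}^N(E\cap B_r(x))/\mathscr{L}^N(B_r(x))$ when it exists. For $u\in\mathscr{B}(\Omega)$, for every $x\in\Omega$, $$u^-(x):=\sup\{t\in\overline{\mathbb{R}}:D(\{u<t\};x)=0\},\quad u^+(x):=\inf\{t\in\overline{\mathbb{R}}:D(\{u>t\};x)=0\},$$ $Z_u:=\{u^+=+\infty,\ u^-=-\infty\}$. For a Borel $\lambda:\Omega\to[0,1]$ set $u^\lambda:=(1-\lambda)u^-+\lambda u^+$ on $\Omega\setminus Z_u$ (with $0\cdot(\pm\infty)=0$), and on $Z_u$: $u^\lambda:=+\infty,\,0,\,-\infty$ according to $\lambda>\frac12$, $\lambda=\frac12$, $\lambda<\frac12$. $\mathcal{DM}_{\rm loc}(\Omega)$ is the set of $\boldsymbol{A}\in\mathcal{M}_{\rm loc}(\Omega;\mathbb{R}^N)$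 with distributional divergence $\mathrm{div}\boldsymbol{A}\in\mathcal{M}_{\rm loc}(\Omega)$. $X^{\boldsymbol{A},\lambda}(\Omega):=\{u\in\mathscr{B}(\Omega):u^\lambda\in L^1(\Omega,|\boldsymbol{A}|)\cap L^1(\Omega,|\mathrm{div}\boldsymbol{A}|)\}$; $X^{\boldsymbol{A},\lambda}_{\rm loc}(\Omega)$ is the analogue with $L^1_{\rm loc}$. For $u\in X^{\boldsymbol{A},\lambda}_{\rm loc}(\Omega)$ the $\lambda$-pairing is the distribution $$\langle(\boldsymbol{A},Du)_\lambda,\varphi\rangle:=-\int_\Omega u^\lambda\varphi\,d\,\mathrm{div}\boldsymbol{A}-\int_\Omega u^\lambda\nabla\varphi\cdot d\boldsymbol{A},$$ $\varphi\in C_c^\infty(\Omega)$, extended to $\varphi\in C^1_c(\Omega)$ by the same formula. $BV^{\boldsymbol{A},\lambda}(\Omega):=\{u\in X^{\boldsymbol{A},\lambda}(\Omega):(\boldsymbol{A},Du)_\lambda\in\mathcal{M}(\Omega)\}$. A sequence $(u_n)_n\subset X^{\boldsymbol{A},\lambda}_{\rm loc}(\Omega)$ $(\boldsymbol{A},\lambda)$-converges to $u\in X^{\boldsymbol{A},\lambda}_{\rm loc}(\Omega)$ if $u_n^\lambda\rightharpoonup u^\lambda$ weakly in $L^1_{\rm loc}(\Omega,|\boldsymbol{A}|)$ and weakly in $L^1_{\rm loc}(\Omega,|\mathrm{div}\boldsymbol{A}|)$ (weak convergence in $L^1_{\rm loc}(\Omega,\mu)$ means weak convergence in $L^1(\Omega',\mu)$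 for every open $\Omega'\Subset\Omega$). *)

(* Defs.v *)
From HB Require Import structures.
From mathcomp Require Import all_boot all_order all_algebra.
From mathcomp Require Import all_classical all_reals all_analysis.

Set Implicit Arguments.
Unset Strict Implicit.
Unset Printing Implicit Defensive.

Import Order.TTheory GRing.Theory Num.Theory numFieldNormedType.Exports.

Local Open Scope classical_set_scope.
Local Open Scope ring_scope.

(* The measurable subsets of R^N are the Borel sets. *)
HB.instance Definition _ (R : realType) (m n : nat) :=
  Measurable.copy 'M[R]_(m, n) (g_sigma_algebraType (@open 'M[R]_(m, n))).

Section euclidean_space.
Context {R : realType} {N : nat}.
Local Notation T := 'rV[R]_N.
Implicit Types (x v : T) (E Om : set T) (phi : T -> R).

(* The library norm of 'rV[R]_N is the sup norm; it is only used through the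
   topology it induces. *)
Definition euclid_norm v : R := Num.sqrt (\sum_(i < N) v 0 i ^+ 2).

Definition euclid_ball x (r : R) : set T :=
  [set y | euclid_norm (y - x) < r].

Definition box (a b : T) : set T :=
  [set y | forall i : 'I_N, a 0 i <= y 0 i < b 0 i].

(* N-dimensional Lebesgue outer measure; on Borel sets it is L^N. *)
Definition lebesgueN E : \bar R :=
  ereal_inf [set (\sum_(0 <= k <oo) (\prod_(i < N) (ab.2 k 0 i - ab.1 k 0 i))%:E)%E
    | ab in [set ab : (nat -> T) * (nat -> T) |
        (forall k (i : 'I_N), ab.1 k 0 i <= ab.2 k 0 i) /\
        E `<=` \bigcup_k box (ab.1 k) (ab.2 k)]].

(* D(E; x) exists and equals l. *)
Definition has_density E x (l : R) : Prop :=
  (fun r : R => fine (lebesgueN (E `&` euclid_ball x r)) /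
                fine (lebesgueN (euclid_ball x r))) @ 0^'+ --> l.

Definition compactly_inside E Om : Prop :=
  compact (closure E) /\ closure E `<=` Om.

Definition partial (i : 'I_N) phi : T -> R :=
  fun x => 'D_(delta_mx 0 i : T) phi x.

Fixpoint Ck (k : nat) phi : Prop :=
  if k is k'.+1 then
    continuous phi /\
    forall i : 'I_N, (forall x, derivable phi x (delta_mx 0 i : T)) /\
                     Ck k' (partial i phi)
  else continuous phi.

(* Functions with compact support in Om are extended by 0 to the whole space. *)
Definition Cck (k : nat) Om phi : Prop :=
  Ck k phi /\ compactly_inside [set x | phi x != 0] Om.

Definition Ccinfty Om phi : Prop := forall k, Cck k Om phi.

End euclidean_space.

Section radon_measures.
Context {R : realType} {N : nat}.
Local Notation T := 'rV[R]_N.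
Variable Om : set T.

(* A locally finite signed Radon measure on Om is a set function which is a
   signed measure on the Borel subsets of each compact subset of Om; its values
   on sets that are not relatively compact in Om are meaningless. *)
Definition radon_loc (mu : set T -> R) : Prop :=
  forall K : set T, compact K -> K `<=` Om ->
  exists nu : {charge set T -> \bar R},
    forall B, measurable B -> B `<=` K -> (mu B)%:E = nu B.

Definition radon_fin (mu : set T -> R) : Prop :=
  exists nu : {charge set T -> \bar R},
    forall B, measurable B -> B `<=` Om -> (mu B)%:E = nu B.

Definition component (A : set T -> 'rV[R]_N) (i : 'I_N) : set T -> R :=
  fun B => A B 0 i.

Definition radon_loc_vec (A : set T -> 'rV[R]_N) : Prop :=
  forall i, radon_loc (component A i).

(* Total variation, for the norm nrm on the target of mu: supremum over the
   countable Borel partitions of E (inside Om) into sets relatively compact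
   in Om. *)
Definition variation (V : Type) (nrm : V -> R) (mu : set T -> V)
    (E : set T) : \bar R :=
  ereal_sup [set (\sum_(0 <= h <oo) (nrm (mu (F h)))%:E)%E
    | F in [set F : nat -> set T |
        [/\ forall h, measurable (F h),
            forall h, compactly_inside (F h) Om,
            trivIset [set: nat] F &
            \bigcup_h F h = E `&` Om]]].

Definition tv (mu : set T -> R) : set T -> \bar R :=
  variation (fun r : R => `|r|) mu.

Definition tv_vec (A : set T -> 'rV[R]_N) : set T -> \bar R :=
  variation (@euclid_norm R N) A.

(* Positive part of the Jordan decomposition of mu. *)
Definition upper_variation (mu : set T -> R) (E : set T) : \bar R :=
  ereal_sup [set (mu F)%:E
    | F in [set F : set T |
        [/\ measurable F, compactly_inside F Om & F `<=` E]]].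

(* Integral over Om, meaningful when f is integrable with respect to tv mu. *)
Definition signed_integral (mu : set T -> R) (f : T -> \bar R) : R :=
  fine (\int[upper_variation mu]_(x in Om) f x -
        \int[upper_variation (fun B => - mu B)%R]_(x in Om) f x)%E.

Definition weak_cvg_measures (mu_ : nat -> set T -> R) (mu : set T -> R) :=
  forall phi : T -> R, Cck 0 Om phi ->
    (fun n => signed_integral (mu_ n) (EFin \o phi)) @ \oo -->
    signed_integral mu (EFin \o phi).

Definition distributional_divergence (A : set T -> 'rV[R]_N)
    (dA : set T -> R) : Prop :=
  forall phi : T -> R, Ccinfty Om phi ->
    signed_integral dA (EFin \o phi) =
    - \sum_(i < N) signed_integral (component A i) (EFin \o partial i phi).

(* A belongs to DM_loc(Om), with divergence dA. *)
Definition DMloc (A : set T -> 'rV[R]_N) (dA : set T -> R) : Prop :=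
  [/\ radon_loc_vec A, radon_loc dA & distributional_divergence A dA].

End radon_measures.

Section representatives.
Context {R : realType} {N : nat}.
Local Notation T := 'rV[R]_N.
Variables (Om : set T) (u : T -> R).

Definition uminus (x : T) : \bar R :=
  ereal_sup [set t : \bar R |
    has_density [set y | Om y /\ ((u y)%:E < t)%E] x 0].

Definition uplus (x : T) : \bar R :=
  ereal_inf [set t : \bar R |
    has_density [set y | Om y /\ (t < (u y)%:E)%E] x 0].

Definition ulambda (lam : T -> R) (x : T) : \bar R :=
  if (uplus x == +oo%E) && (uminus x == -oo%E) then
    if 2^-1 < lam x then +oo%E else if lam x == 2^-1 then 0%E else -oo%E
  else ((1 - lam x)%:E * uminus x + (lam x)%:E * uplus x)%E.

End representatives.

Section weak_L1.
Context {R : realType} {N : nat}.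
Local Notation T := 'rV[R]_N.

Definition Linfty (mu : set T -> \bar R) (D : set T) (g : T -> R) : Prop :=
  measurable_fun D g /\
  exists M : R, \forall x \ae mu, D x -> `|g x| <= M.

(* Weak convergence in L^1(D, mu), tested against the dual L^infty(D, mu). *)
Definition weak_cvg_L1 (mu : set T -> \bar R) (D : set T)
    (f_ : nat -> T -> \bar R) (f : T -> \bar R) : Prop :=
  forall g : T -> R, Linfty mu D g ->
    (fun n => \int[mu]_(x in D) (f_ n x * (g x)%:E))%E @ \oo -->
    (\int[mu]_(x in D) (f x * (g x)%:E))%E.

Definition weak_cvg_L1loc (Om : set T) (mu : set T -> \bar R)
    (f_ : nat -> T -> \bar R) (f : T -> \bar R) : Prop :=
  forall D : set T, open D -> compactly_inside D Om -> weak_cvg_L1 mu D f_ f.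

Definition L1loc (Om : set T) (mu : set T -> \bar R) (f : T -> \bar R) : Prop :=
  forall D : set T, open D -> compactly_inside D Om -> mu.-integrable D f.

End weak_L1.

(* In this section dA stands for div A. Elements of B(Om) are given by Borel
   representatives u, whose values outside Om are irrelevant. *)
Section lambda_pairing.
Context {R : realType} {N : nat}.
Local Notation T := 'rV[R]_N.
Variables (Om : set T) (A : set T -> 'rV[R]_N) (dA : set T -> R) (lam : T -> R).

Definition X (u : T -> R) : Prop :=
  [/\ measurable_fun Om u,
      (tv_vec Om A).-integrable Om (ulambda Om u lam) &
      (tv Om dA).-integrable Om (ulambda Om u lam)].

Definition Xloc (u : T -> R) : Prop :=
  [/\ measurable_fun Om u,
      L1loc Om (tv_vec Om A) (ulambda Om u lam) &
      L1loc Om (tv Om dA) (ulambda Om u lam)].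

Definition pairing (u phi : T -> R) : R :=
  - signed_integral Om dA (fun x => ulambda Om u lam x * (phi x)%:E)%E
  - \sum_(i < N) signed_integral Om (component A i)
      (fun x => ulambda Om u lam x * (partial i phi x)%:E)%E.

(* The distribution (A, Du)_lam is the finite Radon measure mu. *)
Definition pairing_is_measure (u : T -> R) (mu : set T -> R) : Prop :=
  radon_fin Om mu /\
  forall phi : T -> R, Ccinfty Om phi ->
    pairing u phi = signed_integral Om mu (EFin \o phi).

Definition BV (u : T -> R) : Prop := X u /\ exists mu, pairing_is_measure u mu.

Definition A_lambda_cvg (u_ : nat -> T -> R) (u : T -> R) : Prop :=
  weak_cvg_L1loc Om (tv_vec Om A)
    (fun n => ulambda Om (u_ n) lam) (ulambda Om u lam) /\
  weak_cvg_L1loc Om (tv Om dA)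
    (fun n => ulambda Om (u_ n) lam) (ulambda Om u lam).

End lambda_pairing.

(* Main.v *)
(** On a relatively compact open set D the positive and negative variations of
    div A and of the components A_i are measures dominated by |div A| and |A|, so
    by Radon-Nikodym they have densities in [0, 1].  Integrating u^lambda phi
    against such a measure is therefore testing u^lambda against an element of
    L^infty(D, |div A|) or L^infty(D, |A|), and the pairings converge by weak L^1
    convergence.

    For the lower semicontinuity, the total variation of a finite measure mu is
    the supremum of the integrals of psi over psi smooth, compactly supported and
    |psi| <= 1: the Borel sets whose indicator is an L^1(|mu|)-limit of smooth
    compactly supported functions with values in [0, 1] form a sigma-algebra that
    contains the balls, because B / (B + 1/n) tends to the indicator of the ball
    supporting the bump B; one then approximates the two sets of a Hahn
    decomposition of mu.  Weak convergence of the measures follows from convergence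
    on smooth functions by uniform approximation and the bound on the masses. *)
Require Import Defs.
From HB Require Import structures.
From mathcomp Require Import all_boot all_order all_algebra.
From mathcomp Require Import all_classical all_reals all_analysis.
From mathcomp Require Import measurable_realfun ring lra.

Set Implicit Arguments.
Unset Strict Implicit.
Unset Printing Implicit Defensive.

Import Order.TTheory GRing.Theory Num.Theory numFieldNormedType.Exports.

Local Open Scope classical_set_scope.
Local Open Scope ring_scope.

(** * Relatively compact open sets *)

Section euclid_topology.
Context {R : realType} {N : nat}.
Local Notation T := 'rV[R]_N.
Implicit Types (E F U K : set T) (f : T -> R).

(** The Radon measures are plain real set functions, meaningful only on sets that are relatively
    compact in [Om] or, for finite ones, on Borel subsets of [Om]. Their variations are suprema over
    relatively compact sets, so neither the measure axioms nor the linearity of [signed_integral]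
    comes for free. Each variation is therefore matched with a genuine measure that agrees with it
    on Borel sets; integrals depend only on values on Borel sets, so they may be computed with that
    measure. Because the competitors in the suprema are relatively compact, sigma-additivity is used
    only where it is known.

    The tests in the weak convergence must not depend on n. They do not: each is a product of [phi],
    or of a partial derivative of [phi], with a density that comes from div A or A alone.

    The measures representing the pairings are tied to them by smooth functions only. This forces
    smooth approximation twice: in L^1 of the total variation, to recover the mass, and uniformly,
    to reach continuous functions. In the second case the error is multiplied by the mass, which is
    where bounded masses enter. *)

Lemma open_measurable_rV U : open U -> measurable U.
Proof. by move=> oU; exact: sub_sigma_algebra. Qed.

Lemma continuous_measurable_rV E f : continuous f -> measurable_fun E f.
Proof.
move=> cf; apply: measurable_funTS.
apply: (measurability _ (RGenOInfty.measurableE R)) => _ [_ [a ->] <-].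
rewrite setTI; apply: open_measurable_rV.
by apply: open_comp => // x _; exact: cf.
Qed.

Lemma compactly_inside_sub E F U :
  E `<=` F -> compactly_inside F U -> compactly_inside E U.
Proof.
move=> EF [cF FU]; split; last exact: subset_trans (closure_subset EF) FU.
exact: subclosed_compact (@closed_closure _ _) cF (closure_subset EF).
Qed.

Lemma compactly_inside_subr E U V :
  U `<=` V -> compactly_inside E U -> compactly_inside E V.
Proof. by move=> UV [cE EU]; split => //; exact: subset_trans UV. Qed.

Lemma compactly_inside_subset E U : compactly_inside E U -> E `<=` U.
Proof. by move=> [_]; apply: subset_trans; exact: subset_closure. Qed.

Lemma compactly_inside0 U : compactly_inside set0 U.
Proof. by split; rewrite closure0; [exact: compact0|]. Qed.

Lemma compactly_insideU E F U : compactly_inside E U ->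
  compactly_inside F U -> compactly_inside (E `|` F) U.
Proof.
move=> [cE EU] [cF FU]; split; rewrite closureU; last by rewrite subUset.
exact: compactU.
Qed.

Lemma compactly_inside_bigcup (E_ : nat -> set T) U n :
  (forall i, compactly_inside (E_ i) U) ->
  compactly_inside (\bigcup_(i < n) E_ i) U.
Proof.
move=> EU; rewrite bigcup_mkord; elim/big_ind : _ => //.
- exact: compactly_inside0.
- by move=> ? ? ? ?; exact: compactly_insideU.
Qed.

Lemma ball_rVE (a y : T) (r : R) : 0 < r ->
  ball a r y <-> forall i, `|a 0 i - y 0 i| < r.
Proof.
move=> r0; split => [[_ h] i|h]; first exact: h.
by split => // i j; rewrite (ord1 i); exact: h.
Qed.

(** Balls of the sup norm are cubes. The closed cube of half-side [r] is compact as a product of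
    segments, and it lies in the ball of radius [e]. *)
Lemma ball_compactly_inside (a : T) (r e : R) U : 0 < r -> r < e ->
  ball a e `<=` U -> compactly_inside (ball a r) U.
Proof.
move=> r0 re eU.
pose B : set T := [set y | forall i, y 0 i \in `[a 0 i - r, a 0 i + r]].
have cB : compact B.
  apply: (@rV_compact _ _ (fun i => `[a 0 i - r, a 0 i + r]%classic)) => i.
  exact: segment_compact.
have BU : B `<=` U.
  move=> y By; apply: eU; apply/ball_rVE; first exact: lt_trans re.
  move=> i; apply: le_lt_trans re; have := By i; rewrite in_itv/= ler_norml.
  by move=> /andP[]; lra.
have rB : ball a r `<=` B.
  move=> y /ball_rVE => /(_ r0) h i; have := h i; rewrite in_itv/= ltr_norml.
  by move=> /andP[]; lra.
have clB : closed B by apply: compact_closed cB; exact: norm_hausdorff.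
split.
  apply: subclosed_compact cB _; first exact: closed_closure.
  by rewrite (closure_id B).1//; exact: closure_subset.
by apply: subset_trans BU; rewrite (closure_id B).1//; exact: closure_subset.
Qed.

(** Rational centres and radii 1/(k+1) give countably many balls, enumerated through [unpickle].
    Those that are not relatively compact in [U] are replaced by the empty set, hence the
    alternative in the conclusion. *)
Lemma open_bigcup_ball U : open U ->
  exists F : nat -> set T, U = \bigcup_n F n /\
    forall n, F n = set0 \/ exists a r,
      [/\ 0 < r, F n = ball a r & compactly_inside (ball a r) U].
Proof.
move=> oU.
pose B (p : 'rV[rat]_N * nat) : set T :=
  ball (map_mx ratr p.1 : T) p.2.+1%:R^-1.
pose F n : set T := if unpickle n is Some p then
  (if `[< compactly_inside (B p) U >] then B p else set0) else set0.
exists F; split; last first.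
  move=> n; rewrite /F; case: unpickle => [p|]; last by left.
  by case: asboolP => Bp; [right; exists (map_mx ratr p.1 : T), p.2.+1%:R^-1|left].
apply/seteqP; split => [x Ux|x [n _]]; last first.
  rewrite /F; case: unpickle => // p; case: asboolP => // Bp.
  exact: compactly_inside_subset.
have /nbhs_ballP[e /= e0 eU] : nbhs x U by exact: open_nbhs_nbhs.
(* With [d] = 1/(k+1) below e/2 and [q] within [d] of [x], the ball of radius [d] at [q] contains
   [x], while the ball of radius e/2 at [q] stays inside the ball of radius [e] at [x]. *)
have [k ke] : exists k : nat, k.+1%:R^-1 < e / 2 :> R.
  exists (Num.truncn (2 * e^-1)); set k := Num.truncn _.
  have h : 2 * e^-1 < k.+1%:R by exact: truncnS_gt.
  rewrite -[e / 2]invrK ltf_pV2 ?posrE ?ltr0n ?invr_gt0 ?divr_gt0//.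
  by rewrite invfM invrK mulrC.
have : 0 < k.+1%:R^-1 :> R by rewrite invr_gt0.
move: ke; set d : R := k.+1%:R^-1 => ke d0.
have [q qx] : exists q : 'rV[rat]_N, forall i, `|ratr (q 0 i) - x 0 i| < d.
  have h i : exists q : rat, `|ratr q - x 0 i| < d.
    have [|q] := @rat_in_itvoo _ (x 0 i - d) (x 0 i + d).
      by lra.
    by rewrite in_itv/= => /andP[q1 q2]; exists q; rewrite ltr_norml; lra.
  exists (\row_i sval (cid (h i))) => i; rewrite mxE.
  by case: cid.
exists (pickle (q, k)) => //; rewrite /F pickleK.
case: asboolP => [_|]; first by apply/ball_rVE => // i; rewrite mxE.
case; apply: (@ball_compactly_inside _ _ (e / 2)) => // y /ball_rVE yq.
apply: eU; apply/ball_rVE => // i.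
have := yq _ i; rewrite divr_gt0// => /(_ isT); rewrite mxE.
by have := qx i; move: ke; rewrite !ltr_norml => ? /andP[? ?] /andP[? ?]; lra.
Qed.

Lemma open_bigcup_compactly_inside U : open U ->
  exists F : nat -> set T, U = \bigcup_n F n /\
    forall n, open (F n) /\ compactly_inside (F n) U.
Proof.
move=> /open_bigcup_ball[F [UF hF]]; exists F; split=> // n.
have [->|[a [r [r0 -> ?]]]] := hF n.
  by split; [exact: open0|exact: compactly_inside0].
by split=> //; exact: ball_open.
Qed.

Lemma compact_open_between K U : open U -> compact K -> K `<=` U ->
  exists D, [/\ open D, K `<=` D & compactly_inside D U].
Proof.
move=> oU cK KU.
have [F [UF hF]] := open_bigcup_compactly_inside oU.
move: cK; rewrite compact_cover => /(_ nat setT F) [||G _ KG].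
- by move=> n _; exact: (hF n).1.
- by rewrite /cover; rewrite -UF.
pose n := (\max_(i <- finmap.enum_fset G) i).+1.
exists (\bigcup_(i < n) F i); split.
- by apply: bigcup_open => i _; exact: (hF i).1.
- move=> x /KG[i /= iG Fi]; exists i => //=.
  rewrite /n ltnS; exact: leq_bigmax_seq.
- by apply: compactly_inside_bigcup => i; exact: (hF i).2.
Qed.

Lemma support_compl_derive f (v x : T) :
  ~ closure [set y | f y != 0] x -> 'D_v f x = 0.
Proof.
move=> nx.
rewrite (@near_eq_derive _ _ _ _ (cst 0)); first by rewrite derive_cst.
have : nbhs x (~` closure [set y | f y != 0]).
  by apply: open_nbhs_nbhs; split=> //; apply: closed_openC; exact: closed_closure.
apply: filterS => y /= ny; apply/eqP; apply: contrapT => /negP fy; apply: ny.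
exact: subset_closure.
Qed.

Lemma continuous_compact_bounded f K : continuous f -> compact K ->
  exists M, forall x, K x -> `|f x| <= M.
Proof.
move=> cf cK.
have /compact_bounded[M [_ hM]] : compact (f @` K).
  by apply: continuous_compact => //; apply: continuous_subspaceT.
exists (M + 1) => x Kx; apply: hM; first by rewrite ltrDl.
by exists x.
Qed.

End euclid_topology.

(** * Measures from set functions *)

Section extended_reals.
Context {R : realType}.
Local Open Scope ereal_scope.

(** Serves the superadditivity of variations. When [c] is finite, the bounds from below by -oo make
    all elements of both sets finite, so the suprema can be taken one after the other by
    subtraction. *)
Lemma ereal_supD_le (S S' : set (\bar R)) (c : \bar R) :
  S !=set0 -> S' !=set0 ->
  (forall x, S x -> -oo < x) -> (forall y, S' y -> -oo < y) ->
  (forall x y, S x -> S' y -> x + y <= c) ->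
  ereal_sup S + ereal_sup S' <= c.
Proof.
move=> [x0 Sx0] [y0 Sy0] Sgt Sgt' Sc.
have [->|cy] := eqVneq c +oo; first exact: leey.
have cfin : c \is a fin_num.
  rewrite fin_numElt ltey cy andbT (lt_le_trans _ (Sc _ _ Sx0 Sy0))//.
  by rewrite lteNye; move: (Sgt _ Sx0) (Sgt' _ Sy0); case: (x0) => //; case: (y0).
have Sfin x : S x -> x \is a fin_num.
  move=> Sx; rewrite fin_numElt Sgt//= ltey; apply/eqP => xy.
  have := Sc _ _ Sx Sy0; rewrite xy.
  by rewrite addye ?gt_eqF ?Sgt'// leye_eq (negPf cy).
have Sfin' y : S' y -> y \is a fin_num.
  move=> Sy; rewrite fin_numElt Sgt'//= ltey; apply/eqP => yy.
  have := Sc _ _ Sx0 Sy; rewrite yy.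
  by rewrite addey ?gt_eqF ?Sgt// leye_eq (negPf cy).
have supS' x : S x -> ereal_sup S' <= c - x.
  move=> Sx; apply: ge_ereal_sup => y Sy.
  by rewrite leeBrDr ?Sfin// addeC Sc.
have fS' : ereal_sup S' \is a fin_num.
  rewrite fin_numElt (lt_le_trans (Sgt' _ Sy0))/=; last exact: ereal_sup_ubound.
  rewrite (le_lt_trans (supS' _ Sx0))// ltey_eq fin_numB cfin.
  by rewrite Sfin.
rewrite -leeBrDr//; apply: ge_ereal_sup => x Sx.
by rewrite leeBrDr// addeC -leeBrDr ?Sfin// supS'.
Qed.

(** Merges countable partitions of two disjoint sets into one of their union: [f] occupies the even
    indices, [g] the odd ones. *)
Definition interleave (U : Type) (f g : nat -> U) (n : nat) : U :=
  if odd n then g n./2 else f n./2.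

Lemma sum_interleave (f g : nat -> \bar R) (n : nat) :
  \sum_(0 <= i < n) (f i + g i) = \sum_(0 <= i < n.*2) interleave f g i.
Proof.
elim: n => [|n IH]; first by rewrite !big_nil.
rewrite doubleS !big_nat_recr//= IH /interleave/= odd_double/= addeA.
by rewrite uphalf_double half_double.
Qed.

Lemma nneseries_interleave (f g : nat -> \bar R) :
  (forall i, 0 <= f i) -> (forall i, 0 <= g i) ->
  \sum_(0 <= i <oo) f i + \sum_(0 <= i <oo) g i <=
  \sum_(0 <= i <oo) interleave f g i.
Proof.
move=> f0 g0; rewrite -nneseriesD//; apply: lime_le.
  by apply: is_cvg_nneseries => i _ _; rewrite adde_ge0.
apply: nearW => n; rewrite sum_interleave; apply: nneseries_lim_ge => i _ _.
by rewrite /interleave; case: ifP.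
Qed.

Lemma nneseries_single (f : nat -> \bar R) :
  (forall i, 0 <= f i) -> (forall i, f i.+1 = 0) -> \sum_(0 <= i <oo) f i = f 0%N.
Proof.
move=> f0 f1; rewrite nneseries_recl// eseries0 ?adde0// => -[//|i] _ _.
exact: f1.
Qed.

End extended_reals.

Section measure_of_set_function.
Context d {T : measurableType d} {R : realType}.
Local Open Scope ereal_scope.

(* An arbitrary set function may take any value on nonmeasurable sets, hence the
   extension by 0. *)
Lemma measure_of_superadditive (p : set T -> \bar R) :
  p set0 = 0 -> (forall E, measurable E -> 0 <= p E) ->
  (forall E F, measurable E -> measurable F -> E `&` F = set0 ->
    p E + p F <= p (E `|` F)) ->
  (forall E : nat -> set T, (forall i, measurable (E i)) ->
    trivIset setT E -> p (\bigcup_n E n) <= \sum_(0 <= i <oo) p (E i)) ->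
  exists m : {measure set T -> \bar R}, forall E, measurable E -> p E = m E.
Proof.
move=> p0 pge0 pD psum.
pose m E := if `[< measurable E >] then p E else 0.
have mE E : measurable E -> m E = p E by rewrite /m => ?; case: asboolP.
have m0 : m set0 = 0 by rewrite mE.
have mge0 E : 0 <= m E by rewrite /m; case: asboolP => // ?; exact: pge0.
(* Monotonicity, together with finite superadditivity, bounds the partial sums by [p] of the union;
   this is the converse of the assumed countable subadditivity. *)
have ple E F : measurable E -> measurable F -> E `<=` F -> p E <= p F.
  move=> mE_ mF EF; rewrite -(setDUK EF); apply: le_trans (pD _ _ _ _ _) => //.
  - by rewrite leeDl// pge0//; exact: measurableD.
  - exact: measurableD.
  - by rewrite setDE setICA setICr setI0.
have msa : semi_sigma_additive m.
  move=> E mE_ tE mcup; rewrite mE//.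
  rewrite (eq_cvg _ _ (g := fun n => \sum_(0 <= i < n) p (E i))); last first.
    by move=> n; apply: eq_bigr => i _; exact: mE.
  have cv : cvgn (fun n => \sum_(0 <= i < n) p (E i)).
    by apply: is_cvg_nneseries => i _ _; exact: pge0.
  have -> : p (\bigcup_n E n) = \sum_(0 <= i <oo) p (E i); last exact: cv.
  apply/eqP; rewrite eq_le psum//=; apply: lime_le => //; apply: nearW => n.
  have mU k : measurable (\bigcup_(i < k) E i) by exact: bigcup_measurable.
  have : \sum_(0 <= i < n) p (E i) <= p (\bigcup_(i < n) E i).
    elim: n => [|n IH]; first by rewrite big_nil pge0.
    rewrite big_nat_recr//=; apply: le_trans (leeD IH (lexx _)) _.
    rewrite [in leRHS]bigcup_mkord big_ord_recr/= -bigcup_mkord; apply: pD => //.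
    apply/seteqP; split => // x [[i /= ni Ei] En].
    have /(_ i n) := tE; apply: contraPP => // _ /(_ I I) h.
    by move: ni; rewrite h ?ltnn//; exists x.
  move=> /le_trans; apply; apply: ple => //.
  by move=> x [i _ Ei]; exists i.
exists (HB.pack_for {measure set T -> \bar R} m (isMeasure.Build _ T R m m0 mge0 msa)).
by move=> E /mE <-.
Qed.

Import HBNNSimple.

(** The integral is built from simple functions, whose level sets are measurable, so it ignores
    values on other sets. Integrals against the set functions [tv], [tv_vec] and [upper_variation]
    become integrals against measures in this way. *)
Lemma eq_integral_on_measurable (p m : set T -> \bar R) (D : set T) f :
  (forall E, measurable E -> p E = m E) ->
  \int[p]_(x in D) f x = \int[m]_(x in D) f x.
Proof.
move=> pm; rewrite /integral.
have h (g : {nnsfun T >-> R}) : sintegral p g = sintegral m g.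
  by rewrite /sintegral; apply: eq_fsbigr => r _; rewrite pm//; exact: measurable_funPTI.
by congr (ereal_sup _ - ereal_sup _); apply: eq_imagel => g _; exact: h.
Qed.

End measure_of_set_function.

(** * Radon measures and their upper variation *)

Section euclid_norm.
Context {R : realType} {N : nat}.
Implicit Types v w : 'rV[R]_N.

Lemma euclid_norm_ge0 v : 0 <= euclid_norm v.
Proof. exact: sqrtr_ge0. Qed.

Lemma sqr_euclid_norm v : euclid_norm v ^+ 2 = \sum_(i < N) v 0 i ^+ 2.
Proof. by rewrite sqr_sqrtr// sumr_ge0// => i _; exact: sqr_ge0. Qed.

Lemma ler_abs_euclid_norm v i : `|v 0 i| <= euclid_norm v.
Proof.
rewrite -(ler_pXn2r (ltn0Sn 1)) ?nnegrE ?euclid_norm_ge0// sqr_euclid_norm.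
rewrite real_normK ?num_real// (bigD1 i)//= lerDl sumr_ge0// => j _.
exact: sqr_ge0.
Qed.

Lemma euclid_norm_eq0 v : euclid_norm v = 0 -> v = 0.
Proof.
move=> v0; apply/rowP => i; rewrite mxE; apply/eqP.
by rewrite -normr_eq0 eq_le normr_ge0 andbT -v0 ler_abs_euclid_norm.
Qed.

Lemma euclid_norm0 : euclid_norm (0 : 'rV[R]_N) = 0.
Proof.
rewrite /euclid_norm big1 ?sqrtr0// => i _.
by rewrite mxE expr0n.
Qed.

Lemma euclid_norm_le_sum v : euclid_norm v <= \sum_(i < N) `|v 0 i|.
Proof.
rewrite -(ler_pXn2r (ltn0Sn 1)) ?nnegrE ?euclid_norm_ge0 ?sumr_ge0//.
rewrite sqr_euclid_norm expr2 mulr_suml ler_sum// => i _.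
rewrite -real_normK ?num_real// expr2 ler_wpM2l//.
by rewrite (bigD1 i)//= lerDl sumr_ge0.
Qed.

(** With a and b the norms of [v] and [w], the squared norm of b v - a w equals 2ab(ab - v.w) and is
    nonnegative. *)
Lemma Cauchy_Schwarz_euclid v w :
  \sum_(i < N) v 0 i * w 0 i <= euclid_norm v * euclid_norm w.
Proof.
have [v0|v0] := eqVneq (euclid_norm v) 0.
  rewrite v0 mul0r (euclid_norm_eq0 v0) big1// => i _.
  by rewrite mxE mul0r.
have [w0|w0] := eqVneq (euclid_norm w) 0.
  rewrite w0 mulr0 (euclid_norm_eq0 w0) big1// => i _.
  by rewrite mxE mulr0.
set a := euclid_norm v in v0 *; set b := euclid_norm w in w0 *.
have ab0 : 0 < a * b.
  by rewrite mulr_gt0// lt_neqAle eq_sym euclid_norm_ge0 andbT.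
have : 0 <= \sum_(i < N) (b * v 0 i - a * w 0 i) ^+ 2.
  by rewrite sumr_ge0// => i _; exact: sqr_ge0.
have -> : \sum_(i < N) (b * v 0 i - a * w 0 i) ^+ 2 =
    2 * (a * b) * (a * b - \sum_(i < N) v 0 i * w 0 i).
  transitivity (b ^+ 2 * (\sum_(i < N) v 0 i ^+ 2) +
      a ^+ 2 * (\sum_(i < N) w 0 i ^+ 2)
      - 2 * (a * b) * \sum_(i < N) v 0 i * w 0 i).
    rewrite !mulr_sumr -big_split/= -sumrB; apply: eq_bigr => i _; ring.
  by rewrite -!sqr_euclid_norm -/a -/b; ring.
by rewrite pmulr_rge0 ?subr_ge0// mulr_gt0.
Qed.

End euclid_norm.

Section radon.
Context {R : realType} {N : nat}.
Local Notation T := 'rV[R]_N.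
Variable Om : set T.
Implicit Types (E F : set T) (mu : set T -> R).

Lemma radon_fin_loc mu : radon_fin Om mu -> radon_loc Om mu.
Proof.
move=> [nu nuE] K cK KOm; exists nu => B mB BK; apply: nuE => //.
exact: subset_trans KOm.
Qed.

Lemma radon_locN mu : radon_loc Om mu -> radon_loc Om (fun B => - mu B).
Proof.
move=> h K cK KOm; have [nu nuE] := h K cK KOm.
by exists (copp nu) => B mB BK; rewrite EFinN nuE.
Qed.

Lemma radon_finN mu : radon_fin Om mu -> radon_fin Om (fun B => - mu B).
Proof.
by move=> [nu nuE]; exists (copp nu) => B mB BK; rewrite EFinN nuE.
Qed.

(** The common source of finiteness for all variations: available on sets relatively compact in [Om]
    for locally finite measures, and on [Om] itself for finite ones. *)
Definition dominated_on (mu : set T -> R) E := exists m : {measure set T -> \bar R},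
  (m setT < +oo)%E /\
  forall F, measurable F -> F `<=` E -> (`|mu F|%:E <= m F)%E.

Lemma charge_dominated mu (nu : {charge set T -> \bar R}) E :
  (forall B, measurable B -> B `<=` E -> (mu B)%:E = nu B) -> dominated_on mu E.
Proof.
move=> nuE; have [P [M nuPM]] := Hahn_decomposition nu.
exists (charge_variation nuPM : {measure set T -> \bar R}); split => [|F mF FE].
  by rewrite ltey_eq/= /charge_variation fin_numD !fin_num_measure.
by rewrite -abse_EFin nuE// abse_charge_variation.
Qed.

Lemma radon_loc_dominated mu E : radon_loc Om mu -> compactly_inside E Om ->
  dominated_on mu E.
Proof.
move=> h [cE EOm]; have [nu nuE] := h _ cE EOm.
apply: (@charge_dominated _ nu) => B mB BE; apply: nuE => //.
by apply: subset_trans BE _; exact: subset_closure.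
Qed.

Lemma radon_fin_dominated mu : radon_fin Om mu -> dominated_on mu Om.
Proof. by move=> [nu nuE]; exact: (@charge_dominated _ nu). Qed.

Lemma radon_loc_cvg mu E (F : nat -> set T) : radon_loc Om mu ->
  compactly_inside E Om -> measurable E ->
  (forall i, measurable (F i)) -> trivIset setT F -> \bigcup_i F i = E ->
  (fun n => \sum_(0 <= i < n) mu (F i)) @ \oo --> mu E.
Proof.
move=> h [cE EOm] mE mF tF FE; have [nu nuE] := h _ cE EOm.
have EcE : E `<=` closure E by exact: subset_closure.
have := @charge_semi_sigma_additive _ _ _ nu F mF tF.
rewrite FE => /(_ mE); rewrite -nuE// => /fine_cvg; apply: cvg_trans.
apply: near_eq_cvg; apply: nearW => n /=.
rewrite [in LHS](eq_bigr (fun i => (mu (F i))%:E)) ?sumEFin// => i _.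
rewrite nuE//; apply: subset_trans EcE; rewrite -FE; exact: bigcup_sup.
Qed.

Lemma radon_loc0 mu : radon_loc Om mu -> mu set0 = 0.
Proof.
move=> h; have [||nu nuE] := h set0 => //; first exact: compact0.
by apply: EFin_inj; rewrite nuE// charge0.
Qed.

Lemma radon_locU mu E F : radon_loc Om mu ->
  compactly_inside E Om -> compactly_inside F Om ->
  measurable E -> measurable F -> E `&` F = set0 ->
  mu (E `|` F) = mu E + mu F.
Proof.
move=> h cE cF mE mF EF.
have [cEF EFOm] := compactly_insideU cE cF; have [nu nuE] := h _ cEF EFOm.
have sEF : E `|` F `<=` closure (E `|` F) by exact: subset_closure.
apply: EFin_inj; rewrite EFinD !nuE//.
- by rewrite chargeU.
- by apply: subset_trans sEF; exact: subsetUr.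
- by apply: subset_trans sEF; exact: subsetUl.
- exact: measurableU.
Qed.

Local Open Scope ereal_scope.

Lemma upper_variation_ub mu E F : measurable F -> compactly_inside F Om ->
  F `<=` E -> (mu F)%:E <= upper_variation Om mu E.
Proof. by move=> mF cF FE; apply: ereal_sup_ubound; exists F. Qed.

Lemma upper_variation_ge0 mu E : radon_loc Om mu -> 0 <= upper_variation Om mu E.
Proof.
move=> h; have <- : (mu set0)%:E = 0 by rewrite radon_loc0.
apply: upper_variation_ub => //.
exact: compactly_inside0.
Qed.

(** Competitors for two disjoint sets can be united, which gives superadditivity. A competitor for a
    countable union is relatively compact, so [mu] is sigma-additive on its traces on the pieces,
    which gives countable subadditivity. *)
Lemma upper_variation_measure mu : radon_loc Om mu ->
  exists m : {measure set T -> \bar R}, forall E, measurable E ->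
    upper_variation Om mu E = m E.
Proof.
move=> h; apply: measure_of_superadditive.
- apply/eqP; rewrite eq_le upper_variation_ge0// andbT.
  apply: ge_ereal_sup => _ [F [_ _ F0] <-].
  by move: F0; rewrite subset0 => ->; rewrite (radon_loc0 h).
- by move=> E _; exact: upper_variation_ge0.
- move=> E F mE mF EF0; apply: ereal_supD_le.
  + by exists (mu set0)%:E, set0 => //; split=> //; exact: compactly_inside0.
  + by exists (mu set0)%:E, set0 => //; split=> //; exact: compactly_inside0.
  + by move=> _ [G _ <-]; exact: ltNyr.
  + by move=> _ [G _ <-]; exact: ltNyr.
  + move=> _ _ [G [mG cG GE] <-] [H [mH cH HF] <-].
    rewrite -EFinD -radon_locU//; last by apply: subsetI_eq0 EF0.
    apply: upper_variation_ub; [exact: measurableU|exact: compactly_insideU|].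
    exact: setUSS.
- move=> E mE tE; apply: ge_ereal_sup => _ [F [mF cF FE] <-].
  have FE' : F = \bigcup_i (F `&` E i) by rewrite -setI_bigcupr; apply/esym/setIidl.
  have cFE i : compactly_inside (F `&` E i) Om.
    by apply: compactly_inside_sub cF; exact: subIsetl.
  have mFE i : measurable (F `&` E i) by exact: measurableI.
  have tFE : trivIset setT (fun i => F `&` E i) by exact: trivIset_setIl.
  have := radon_loc_cvg h cF mF mFE tFE (esym FE').
  move=> hc; have {}hc : (fun n => (\sum_(0 <= i < n) mu (F `&` E i))%:E) @ \oo --> (mu F)%:E.
    by apply/fine_cvgP; split => //; apply: nearW.
  rewrite -(cvg_lim _ hc)//; apply: lime_le; first by apply/cvg_ex; exists (mu F)%:E.
  apply: nearW => n; rewrite -sumEFin.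
  apply: (@le_trans _ _ (\sum_(0 <= i < n) upper_variation Om mu (E i))).
    by apply: lee_sum => i _; apply: upper_variation_ub => //; exact: subIsetr.
  by apply: nneseries_lim_ge => i _ _; exact: upper_variation_ge0.
Qed.

Lemma upper_variation_finite mu E : dominated_on mu E -> measurable E ->
  upper_variation Om mu E < +oo.
Proof.
move=> [m [mT hm]] mE; apply: le_lt_trans mT.
apply: (@le_trans _ _ (m E)); last by apply: le_measure; rewrite ?inE.
apply: ge_ereal_sup => _ [F [mF cF FE] <-].
apply: (@le_trans _ _ (m F)); last by apply: le_measure; rewrite ?inE.
by apply: le_trans (hm _ mF FE); rewrite lee_fin ler_norm.
Qed.

End radon.

(** * Total variation *)

Section variation.
Context {R : realType} {N : nat}.
Local Notation T := 'rV[R]_N.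
Variable Om : set T.
Hypothesis Om_open : open Om.
Implicit Types (E : set T).

Local Open Scope ereal_scope.

(** These are the partitions over which [variation] takes its supremum. *)
Definition adapted_partition E (F : nat -> set T) :=
  [/\ forall h, measurable (F h), forall h, compactly_inside (F h) Om,
      trivIset [set: nat] F & \bigcup_h F h = E `&` Om].

(** Prevents the supremum in [variation] from being the one of the empty set, which is -oo. The
    pieces come from making disjoint a countable cover of [Om] by relatively compact open sets. *)
Lemma adapted_partition_exists E : measurable E -> exists F, adapted_partition E F.
Proof.
move=> mE; have [F [OmF hF]] := open_bigcup_compactly_inside Om_open.
exists (fun h => E `&` seqDU F h); split.
- move=> h; apply: measurableI => //; apply: seqDU_measurable => n.
  by apply: open_measurable_rV; exact: (hF n).1.
- move=> h; apply: compactly_inside_sub (hF h).2; apply: subset_trans (@subIsetr _ _ _) _.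
  exact: subset_seqDU.
- by apply: trivIset_setIl; exact: trivIset_seqDU.
- by rewrite -setI_bigcupr -seqDU_bigcup_eq -OmF.
Qed.

Section norm.
Variables (V : Type) (nrm : V -> R) (mu : set T -> V).
Hypothesis nrm_ge0 : forall v, (0 <= nrm v)%R.
Hypothesis nrm_mu0 : nrm (mu set0) = 0%R.

Let nrm_mu_ge0 E : 0 <= (nrm (mu E))%:E. Proof. by rewrite lee_fin. Qed.

Lemma variation_ub E F : adapted_partition E F ->
  \sum_(0 <= h <oo) (nrm (mu (F h)))%:E <= Defs.variation Om nrm mu E.
Proof. by move=> hF; apply: ereal_sup_ubound; exists F. Qed.

Lemma variation_ge0 E : measurable E -> 0 <= Defs.variation Om nrm mu E.
Proof.
move=> /adapted_partition_exists[F hF]; apply: le_trans (variation_ub hF).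
by apply: nneseries_ge0 => *; exact: nrm_mu_ge0.
Qed.

Lemma nrm_le_variation E : measurable E -> compactly_inside E Om ->
  (nrm (mu E))%:E <= Defs.variation Om nrm mu E.
Proof.
move=> mE cE; pose F (n : nat) : set T := if n is 0%N then E else set0.
have hF : adapted_partition E F.
  split.
  - by case=> [|n] /=; [exact: mE|exact: measurable0].
  - by case=> [|n] /=; [exact: cE|exact: compactly_inside0].
  - move=> [|i] [|j] _ _ // [x []] //=.
  - apply/seteqP; split => [x [[|n]//= _ Ex]|x [Ex _]]; last by exists 0%N.
    by split=> //; exact: (compactly_inside_subset cE).
apply: le_trans (variation_ub hF); rewrite nneseries_single//= => i.
by rewrite nrm_mu0.
Qed.

Lemma variation_finite E (m : {measure set T -> \bar R}) : measurable E ->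
  (forall F, measurable F -> compactly_inside F Om -> F `<=` E ->
    (nrm (mu F))%:E <= m F) ->
  Defs.variation Om nrm mu E <= m E.
Proof.
move=> mE hm; apply: ge_ereal_sup => _ [F [mF cF tF FE] <-].
have FsE h : F h `<=` E.
  by apply: subset_trans (@subIsetl _ E Om); rewrite -FE; exact: bigcup_sup.
apply: (@le_trans _ _ (\sum_(0 <= h <oo) m (F h))).
  by apply: lee_nneseries => [h _ _|h _]; [exact: nrm_mu_ge0|exact: hm].
rewrite -measure_semi_bigcup//; last exact: bigcup_measurable.
apply: le_measure; rewrite ?inE//; first exact: bigcup_measurable.
by rewrite FE; exact: subIsetl.
Qed.

(** The hypothesis isolates the countable triangle inequality, the only point where scalar and
    vector measures differ. Interleaving partitions gives superadditivity; cutting each [F h] along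
    the [E i] and exchanging the two sums gives countable subadditivity. *)
Lemma variation_measure :
  (forall E (F : nat -> set T), measurable E -> compactly_inside E Om ->
    (forall h, measurable (F h)) -> trivIset [set: nat] F -> \bigcup_h F h = E ->
    (nrm (mu E))%:E <= \sum_(0 <= h <oo) (nrm (mu (F h)))%:E) ->
  exists m : {measure set T -> \bar R}, forall E, measurable E ->
    Defs.variation Om nrm mu E = m E.
Proof.
move=> nsub; apply: measure_of_superadditive.
- apply/eqP; rewrite eq_le variation_ge0// andbT.
  apply: ge_ereal_sup => _ [F [_ _ _ F0] <-]; rewrite eseries0// => i _ _.
  suff -> : F i = set0 by rewrite nrm_mu0.
  by apply/seteqP; split => // x Fx; rewrite -(set0I Om) -F0; exists i.
- by move=> E; exact: variation_ge0.
- move=> E F mE mF EF0.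
  have vgt G x : [set \sum_(0 <= h <oo) (nrm (mu (H h)))%:E |
      H in adapted_partition G] x -> -oo < x.
    move=> [H _ <-]; apply: (@lt_le_trans _ _ 0) => //.
    by apply: nneseries_ge0 => *; exact: nrm_mu_ge0.
  apply: ereal_supD_le.
  + by have [G hG] := adapted_partition_exists mE; eexists; exists G.
  + by have [G hG] := adapted_partition_exists mF; eexists; exists G.
  + by move=> x Hx; apply: (vgt E).
  + by move=> x Hx; apply: (vgt F).
  + move=> _ _ [G [mG cG tG GE] <-] [H [mH cH tH HF] <-].
    apply: le_trans (nneseries_interleave _ _) _ => //.
    rewrite (eq_eseriesr (g := fun h => (nrm (mu (interleave G H h)))%:E)); last first.
      by move=> i _; rewrite /interleave; case: ifP.
    apply: variation_ub; split.
    * by move=> h; rewrite /interleave; case: ifP.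
    * by move=> h; rewrite /interleave; case: ifP.
    * have GH i j : G i `&` H j !=set0 -> False.
        move=> [x [Gx Hx]]; have : set0 x; last by [].
        rewrite -EF0; split.
          have : (E `&` Om) x by rewrite -GE; exists i.
          by case.
        have : (F `&` Om) x by rewrite -HF; exists j.
        by case.
      move=> i j _ _; rewrite /interleave; case: ifP => oi; case: ifP => oj h.
      - by rewrite -(odd_double_half i) oi -(odd_double_half j) oj (tH _ _ I I h).
      - by move: h; rewrite setIC => /GH.
      - by move: h => /GH.
      - by rewrite -(odd_double_half i) oi -(odd_double_half j) oj (tG _ _ I I h).
    * rewrite setIUl -GE -HF; apply/seteqP; split => [x [i _]|x [[i _ Gi]|[i _ Hi]]].
      - by rewrite /interleave; case: ifP => _ h; [right|left]; exists i./2.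
      - by exists i.*2 => //; rewrite /interleave odd_double half_double.
      - by exists i.*2.+1 => //; rewrite /interleave/= odd_double/= uphalf_double.
- move=> E mE tE; apply: ge_ereal_sup => _ [F [mF cF tF FE] <-].
  apply: (@le_trans _ _ (\sum_(0 <= h <oo) \sum_(0 <= i <oo)
      (nrm (mu (F h `&` E i)))%:E)).
    apply: lee_nneseries => [h _ _|h _]; first exact: nrm_mu_ge0.
    apply: nsub => //.
    + by move=> i; exact: measurableI.
    + exact: trivIset_setIl.
    + rewrite -setI_bigcupr; apply/setIidl.
      by apply: subset_trans (@subIsetl _ _ Om); rewrite -FE; exact: bigcup_sup.
  rewrite nneseries_interchange//.
  apply: lee_nneseries => [i _ _|i _].
    by apply: nneseries_ge0 => *; exact: nrm_mu_ge0.
  apply: variation_ub; split.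
  + by move=> h; exact: measurableI.
  + by move=> h; apply: compactly_inside_sub (cF h); exact: subIsetl.
  + exact: trivIset_setIr.
  + rewrite -setI_bigcupl FE setIAC; congr (_ `&` _); apply/setIidr.
    exact: bigcup_sup.
Qed.

End norm.

Lemma tv_measure (mu : set T -> R) : radon_loc Om mu ->
  exists m : {measure set T -> \bar R}, forall E, measurable E -> tv Om mu E = m E.
Proof.
move=> h; apply: variation_measure.
- by move=> v; exact: normr_ge0.
- by rewrite (radon_loc0 h) normr0.
move=> E F mE cE mF tF FE; have hc := radon_loc_cvg h cE mE mF tF FE.
have {}hc : (fun n => `|\sum_(0 <= i < n) mu (F i)|%:E) @ \oo --> `|mu E|%:E.
  by apply/fine_cvgP; split; [exact: nearW|exact: cvg_norm].
rewrite -(cvg_lim _ hc)//; apply: lime_le; first by apply/cvg_ex; eexists; exact: hc.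
apply: nearW => n; apply: (@le_trans _ _ (\sum_(0 <= i < n) `|mu (F i)|%:E)).
  by rewrite sumEFin lee_fin ler_norm_sum.
by apply: nneseries_lim_ge => i _ _; rewrite lee_fin.
Qed.

(** For the countable triangle inequality both sides are multiplied by a = |A(E)|: a^2 is the limit
    of the partial sums of the scalar products of A(E) with A(F_k), and each of these is at most a
    |A(F_k)| by Cauchy-Schwarz. *)
Lemma tv_vec_measure (A : set T -> 'rV[R]_N) : radon_loc_vec Om A ->
  exists m : {measure set T -> \bar R}, forall E, measurable E -> tv_vec Om A E = m E.
Proof.
move=> h; apply: variation_measure.
- exact: euclid_norm_ge0.
- suff -> : A set0 = 0%R by exact: euclid_norm0.
  by apply/rowP => i; rewrite mxE; exact: (radon_loc0 (h i)).
move=> E F mE cE mF tF FE.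
set a := euclid_norm (A E).
have S0 n : 0 <= \sum_(0 <= i < n) (euclid_norm (A (F i)))%:E.
  by apply: sume_ge0 => i _; rewrite lee_fin euclid_norm_ge0.
set S := \sum_(0 <= i <oo) _.
have SS n : \sum_(0 <= i < n) (euclid_norm (A (F i)))%:E <= S.
  by apply: nneseries_lim_ge => i _ _; rewrite lee_fin euclid_norm_ge0.
have [a0|a0] := eqVneq a 0%R; first by rewrite a0; apply: le_trans (SS 0%N).
have {}a0 : (0 < a)%R by rewrite lt_neqAle eq_sym a0 euclid_norm_ge0.
rewrite -(@lee_pmul2l _ a%:E)// -EFinM -expr2 sqr_euclid_norm.
have hc : (fun n => (\sum_(i < N) A E 0 i * \sum_(0 <= k < n) A (F k) 0 i)%R%:E) @ \oo
    --> (\sum_(i < N) A E 0 i ^+ 2)%R%:E.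
  apply/fine_cvgP; split; first exact: nearW.
  rewrite /comp/=; apply: cvg_big => [|i _]; first exact: add_continuous.
  rewrite expr2; apply: cvgMr.
  exact: (radon_loc_cvg (h i) cE mE mF tF FE).
rewrite -(cvg_lim _ hc)//; apply: lime_le; first by apply/cvg_ex; eexists; exact: hc.
apply: nearW => n.
apply: (@le_trans _ _ (a%:E * \sum_(0 <= i < n) (euclid_norm (A (F i)))%:E)).
  rewrite sumEFin -EFinM lee_fin mulr_sumr.
  under eq_bigr do rewrite mulr_sumr.
  rewrite exchange_big/=; apply: ler_sum => k _; exact: Cauchy_Schwarz_euclid.
by rewrite lee_pmul2l.
Qed.

Lemma tv_finite (mu : set T -> R) E : dominated_on mu E -> measurable E ->
  tv Om mu E < +oo.
Proof.
move=> [m [mT hm]] mE; apply: le_lt_trans mT; apply: (@le_trans _ _ (m E)).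
  by apply: variation_finite => // F mF _; exact: hm.
by apply: le_measure; rewrite ?inE.
Qed.

Lemma tv_vec_finite (A : set T -> 'rV[R]_N) E :
  (forall i, dominated_on (component A i) E) -> measurable E ->
  tv_vec Om A E < +oo.
Proof.
move=> hA mE.
apply: (@le_lt_trans _ _ (\sum_(i < N) tv Om (component A i) E)); last first.
  by apply: lte_sum_pinfty => i _; exact: tv_finite.
apply: ge_ereal_sup => _ [F hF <-].
apply: (@le_trans _ _ (\sum_(0 <= h <oo) \sum_(i < N) `|component A i (F h)|%:E)).
  apply: lee_nneseries => [h _ _|h _]; first by rewrite lee_fin euclid_norm_ge0.
  by rewrite sumEFin lee_fin; exact: euclid_norm_le_sum.
rewrite nneseries_sum; last by move=> i j _; rewrite lee_fin.
by apply: lee_sum => i _; exact: variation_ub.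
Qed.

Lemma upper_variation_le_tv (mu : set T -> R) E : radon_loc Om mu -> measurable E ->
  upper_variation Om mu E <= tv Om mu E.
Proof.
move=> h mE; have [m hm] := tv_measure h.
apply: ge_ereal_sup => _ [F [mF cF FE] <-].
apply: (@le_trans _ _ (tv Om mu F)); last by rewrite !hm// le_measure ?inE.
apply: le_trans (nrm_le_variation _ _ mF cF) => //.
  by rewrite lee_fin ler_norm.
by rewrite (radon_loc0 h) normr0.
Qed.

Lemma upper_variation_le_tv_vec (A : set T -> 'rV[R]_N) i E :
  radon_loc_vec Om A -> measurable E ->
  upper_variation Om (component A i) E <= tv_vec Om A E /\
  upper_variation Om (fun B => - component A i B)%R E <= tv_vec Om A E.
Proof.
move=> h mE; have [m hm] := tv_vec_measure h.
have A0 : euclid_norm (A set0) = 0%R.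
  suff -> : A set0 = 0%R by exact: euclid_norm0.
  by apply/rowP => j; rewrite mxE; exact: (radon_loc0 (h j)).
suff H F : measurable F -> compactly_inside F Om -> F `<=` E ->
    `|component A i F|%:E <= tv_vec Om A E.
  split; apply: ge_ereal_sup => _ [F [mF cF FE] <-];
    apply: le_trans (H F mF cF FE); rewrite lee_fin ?ler_norm//.
  by rewrite -normrN ler_norm.
move=> mF cF FE.
apply: (@le_trans _ _ (tv_vec Om A F)); last by rewrite !hm// le_measure ?inE.
apply: le_trans (nrm_le_variation _ _ mF cF) => //; last exact: euclid_norm_ge0.
by rewrite lee_fin ler_abs_euclid_norm.
Qed.

(** In one direction |mu F| is bounded by the variation that carries its sign. In the other,
    competitors F and G for the two variations may overlap, but their intersection cancels in mu F -
    mu G, which leaves the disjoint sets F minus G and G minus F. *)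
Lemma tv_upper_variation (mu : set T -> R) E : radon_loc Om mu -> measurable E ->
  tv Om mu E =
  upper_variation Om mu E + upper_variation Om (fun B => - mu B)%R E.
Proof.
move=> h mE.
have [m hm] := tv_measure h.
have [p hp] := upper_variation_measure h.
have [q hq] := upper_variation_measure (radon_locN h).
apply/eqP; rewrite eq_le; apply/andP; split.
  rewrite hp// hq// -measure_addE; apply: variation_finite => //.
  move=> F mF cF FE; change (`|mu F|%:E <= measure_add p q F).
  rewrite measure_addE -hp// -hq//.
  have [mu0|mu0] := leP 0%R (mu F).
    rewrite ger0_norm// -[leLHS]adde0 leeD//; first exact: upper_variation_ub.
    exact: upper_variation_ge0 (radon_locN h).
  rewrite ltr0_norm// -[leLHS]add0e leeD//; first exact: upper_variation_ge0.
  exact: (@upper_variation_ub _ _ _ (fun B => - mu B)%R).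
apply: ereal_supD_le.
- by exists (mu set0)%:E, set0 => //; split=> //; exact: compactly_inside0.
- by exists (- mu set0)%:E, set0 => //; split=> //; exact: compactly_inside0.
- by move=> _ [G _ <-]; exact: ltNyr.
- by move=> _ [G _ <-]; exact: ltNyr.
move=> _ _ [F [mF cF FE] <-] [G [mG cG GE] <-].
have cD F' G' : compactly_inside F' Om -> compactly_inside (F' `\` G') Om.
  by apply: compactly_inside_sub; exact: subDsetl.
have cI : compactly_inside (F `&` G) Om.
  by apply: compactly_inside_sub cF; exact: subIsetl.
have muD F' G' : measurable F' -> measurable G' -> compactly_inside F' Om ->
    mu F' = (mu (F' `\` G') + mu (F' `&` G'))%R.
  move=> mF' mG' cF'.
  have cF'G' : compactly_inside (F' `&` G') Om.
    by apply: compactly_inside_sub cF'; exact: subIsetl.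
  rewrite -(radon_locU h)//; [|exact: cD|exact: measurableD|exact: measurableI|].
    by rewrite setUC setUIDK.
  by apply/seteqP; split => // x [[_ nG] [_ /nG]].
apply: (@le_trans _ _ (tv Om mu (F `\` G) + tv Om mu (G `\` F))).
  apply: (@le_trans _ _ (`|mu (F `\` G)|%:E + `|mu (G `\` F)|%:E)); last first.
    have mu0 : `|mu set0|%R = 0%R by rewrite (radon_loc0 h) normr0.
    by apply: leeD; apply: (nrm_le_variation (nrm := fun r : R => `|r|%R)) => //;
      [exact: measurableD|exact: cD|exact: measurableD|exact: cD].
  rewrite -!EFinD lee_fin (muD F G)// (muD G F)// (setIC G F).
  have := ler_norm (mu (F `\` G)); have := ler_norm (- mu (G `\` F))%R.
  by rewrite normrN; lra.
rewrite !hm//; [|exact: measurableD..].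
rewrite -measureU//; [|exact: measurableD|exact: measurableD|].
  apply: le_measure; rewrite ?inE//; first by apply: measurableU; exact: measurableD.
  by rewrite subUset; split; apply: subset_trans (@subDsetl _ _ _) _.
by apply/seteqP; split => // x [[? ?] []].
Qed.

End variation.

(** * Convergence of the pairings *)

Section density.
Context d {T : measurableType d} {R : realType}.
Local Open Scope ereal_scope.

Lemma bounded_density (nu mu : {finite_measure set T -> \bar R}) :
  (forall E, measurable E -> nu E <= mu E) ->
  exists h : T -> R, [/\ measurable_fun setT h,
    \forall x \ae mu, (`|h x| <= 1)%R &
    forall D f, measurable D -> nu.-integrable D f ->
      \int[nu]_(x in D) f x = \int[mu]_(x in D) (f x * (h x)%:E)].
Proof.
move=> numu.
have dom : nu `<< mu.
  apply/null_content_dominatesP => E mE muE0; apply/eqP.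
  by rewrite eq_le measure_ge0 andbT -muE0 numu.
pose g := Radon_Nikodym (charge_of_finite_measure nu) mu.
have gfin x : g x \is a fin_num by exact: Radon_Nikodym_fin_num.
have ig : mu.-integrable setT g by exact: Radon_Nikodym_integrable.
have mg : measurable_fun setT g by exact: measurable_int ig.
have gE E : measurable E -> \int[mu]_(x in E) g x = nu E.
  by move=> mE; rewrite -Radon_Nikodym_integral.
exists (fine \o g); split.
- exact: measurableT_comp.
- have g0 : ae_eq mu setT (Radon_Nikodym_SigmaFinite.f nu mu) g.
    exact: ae_eq_Radon_Nikodym_SigmaFinite.
  pose S := [set x | 1 < g x].
  have mS : measurable S by rewrite -[S]setTI; exact: emeasurable_fun_o_infty.
  (* For E inside S = {g > 1} the integral of [g] over E is at least mu E, yet it equals nu E, at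
     most mu E. Hence g = 1 almost everywhere on S, so S is null. *)
  have g1 : ae_eq mu S (cst 1) g.
    apply: integral_ae_eq => //; [|exact: measurable_funTS|].
      exact: finite_measure_integrable_cst.
    move=> E ES mE; have gt1 x : E x -> 1 < g x by exact: ES.
    apply/eqP; rewrite eq_le; apply/andP; split.
      apply: ge0_le_integral => //.
      + exact: measurable_funTS.
      + by move=> x /gt1/ltW.
    by rewrite gE// integral_cst// mul1e numu.
  move: g0 g1; apply: filterS2 => x /= g0 g1.
  have gx0 : 0 <= g x by rewrite -g0//; exact: Radon_Nikodym_SigmaFinite.f_ge0.
  have gx1 : g x <= 1.
    by rewrite leNgt; apply/negP => Sx; have := Sx; rewrite -g1// ltxx.
  by rewrite ger0_norm ?fine_ge0// -lee_fin fineK.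
- move=> D f mD fi; rewrite -(Radon_Nikodym_change_of_variables dom)//.
  by apply: eq_integral => x _ /=; rewrite fineK.
Qed.

End density.

Section weak_L1_integral.
Context {R : realType} {N : nat}.
Local Notation T := 'rV[R]_N.
Variable Om : set T.
Local Open Scope ereal_scope.

Lemma integrable_on_measurable (v : set T -> \bar R) (m : {measure set T -> \bar R})
    (D : set T) f : (forall E, measurable E -> v E = m E) ->
  v.-integrable D f <-> m.-integrable D f.
Proof.
move=> vm; split=> /integrableP[mf fi]; apply/integrableP; split=> //.
  by rewrite -(eq_integral_on_measurable _ _ vm).
by rewrite (eq_integral_on_measurable _ _ vm).
Qed.

Lemma integral_vanish_outside (m : {measure set T -> \bar R}) (D E : set T)
    (f : T -> \bar R) : D `<=` E -> (forall x, ~ D x -> f x = 0) ->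
  \int[m]_(x in E) f x = \int[m]_(x in D) f x.
Proof.
move=> DE f0; rewrite integral_mkcond [RHS]integral_mkcond.
congr integral; apply/funext => x; rewrite !patchE.
case: ifPn => [|/negP]; rewrite inE => Ex; case: ifPn => [|/negP]; rewrite inE => Dx //.
  by rewrite f0.
by case: Ex; exact: DE.
Qed.

(** The test is [phi] times the density of [p] with respect to [v] on [D]. It is chosen before [f],
    so that one test serves a whole sequence. Restriction to [D] makes both measures finite, as
    [bounded_density] asks. *)
Lemma integral_as_test (p v : set T -> \bar R) (mp mv : {measure set T -> \bar R})
    (D : set T) (phi : T -> R) :
  (forall E, measurable E -> p E = mp E) ->
  (forall E, measurable E -> v E = mv E) ->
  (forall E, measurable E -> p E <= v E) ->
  measurable D -> D `<=` Om -> v D < +oo ->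
  measurable_fun setT phi -> (exists M, forall x, `|phi x| <= M)%R ->
  (forall x, ~ D x -> phi x = 0%R) ->
  exists g, Linfty v D g /\ forall f, v.-integrable D f ->
    \int[p]_(x in Om) (f x * (phi x)%:E) = \int[v]_(x in D) (f x * (g x)%:E) /\
    \int[p]_(x in Om) (f x * (phi x)%:E) \is a fin_num.
Proof.
move=> pm vm pv mD DOm vD mphi [M phiM] phi0.
have mvD : mv D < +oo by rewrite -vm.
have mpD : mp D < +oo by apply: le_lt_trans vD; rewrite -pm// pv.
pose nu : {finite_measure set T -> \bar R} := mfrestr mD mpD.
pose mu : {finite_measure set T -> \bar R} := mfrestr mD mvD.
have nuD f : \int[mp]_(x in D) f x = \int[nu]_(x in D) f x.
  apply: eq_measure_integral => E mE ED.
  by rewrite /nu/= /mfrestr /mrestr setIidl.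
have muD f : \int[mv]_(x in D) f x = \int[mu]_(x in D) f x.
  apply: eq_measure_integral => E mE ED.
  by rewrite /mu/= /mfrestr /mrestr setIidl.
have numu E : measurable E -> nu E <= mu E.
  move=> mE; have mED : measurable (E `&` D) by exact: measurableI.
  by have := pv _ mED; rewrite pm// vm.
have [h [mh h1 hE]] := bounded_density numu.
exists (fun x => phi x * h x)%R; split.
  split; first by apply: measurable_funTS; exact: measurable_funM.
  exists M; have [B [mB B0 hB]] := h1.
  (* The exceptional set of the density is null for the restriction of [mv] to [D]; only its trace
     on [D] is null for [v]. *)
  exists (B `&` D); split; first exact: measurableI.
    by rewrite vm; [exact: B0|exact: measurableI].
  move=> x /= /not_implyP[Dx hx]; split=> //; apply: hB => /= hx1; apply: hx.
  rewrite normrM -[leRHS]mulr1 ler_pM//.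
move=> f vf; have mvf := (integrable_on_measurable _ _ vm).1 vf.
have mf : measurable_fun D f by exact: measurable_int mvf.
have muf : mu.-integrable D f.
  by apply/integrableP; split=> //; rewrite -muD; have /integrableP[] := mvf.
have nuf : nu.-integrable D f.
  apply/integrableP; split=> //; have /integrableP[_] := muf; apply: le_lt_trans.
  rewrite integral_mkcond [leRHS]integral_mkcond.
  apply: ge0_le_measure_integral => //.
  - by move=> x; rewrite patchE; case: ifP.
  - by apply/(measurable_restrictT _ mD); exact: measurableT_comp.
have nufphi : nu.-integrable D (f \* (EFin \o phi)).
  apply: integrableMl => //; first exact: measurable_funTS.
  exists M; split; first exact: num_real.
  by move=> y My x _ /=; apply: le_trans (phiM x) (ltW My).
have -> : \int[p]_(x in Om) (f x * (phi x)%:E) = \int[nu]_(x in D) (f x * (phi x)%:E).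
  rewrite (eq_integral_on_measurable _ _ pm) (integral_vanish_outside _ DOm) ?nuD//.
  by move=> x Dx; rewrite phi0// mule0.
split; last exact: integrable_fin_num.
rewrite (hE _ (f \* (EFin \o phi)))// (eq_integral_on_measurable _ _ vm) muD.
by apply: eq_integral => x _ /=; rewrite EFinM muleA.
Qed.

(** The two variations of [mu] receive separate tests [g] and [k]; finiteness of both limit
    integrals lets the difference and [fine] pass to the limit. *)
Lemma signed_integral_weak_cvg (mu : set T -> R) (v : set T -> \bar R)
    (mv : {measure set T -> \bar R}) (D : set T) (phi : T -> R)
    (f_ : nat -> T -> \bar R) (f : T -> \bar R) :
  radon_loc Om mu ->
  (forall E, measurable E -> v E = mv E) ->
  (forall E, measurable E -> upper_variation Om mu E <= v E /\
    upper_variation Om (fun B => - mu B)%R E <= v E) ->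
  measurable D -> D `<=` Om -> v D < +oo ->
  measurable_fun setT phi -> (exists M, forall x, `|phi x| <= M)%R ->
  (forall x, ~ D x -> phi x = 0%R) ->
  (forall n, v.-integrable D (f_ n)) -> v.-integrable D f ->
  weak_cvg_L1 v D f_ f ->
  (fun n => signed_integral Om mu (fun x => f_ n x * (phi x)%:E)) @ \oo -->
  signed_integral Om mu (fun x => f x * (phi x)%:E).
Proof.
move=> rmu vm uv mD DOm vD mphi bphi phi0 if_ if1 wcvg.
have [mp hp] := upper_variation_measure rmu.
have [mq hq] := upper_variation_measure (radon_locN rmu).
have [g [Lg hg]] := integral_as_test hp vm (fun E mE => (uv E mE).1)
  mD DOm vD mphi bphi phi0.
have [k [Lk hk]] := integral_as_test hq vm (fun E mE => (uv E mE).2)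
  mD DOm vD mphi bphi phi0.
rewrite /signed_integral; apply: fine_cvg.
rewrite fineK; last by rewrite fin_numB (hg _ if1).2 (hk _ if1).2.
apply: cvgeB.
- by rewrite fin_num_adde_defr//; exact: (hg _ if1).2.
- rewrite (hg _ if1).1; have := wcvg g Lg; apply: cvg_trans; apply: near_eq_cvg.
  by apply: nearW => n; rewrite (hg _ (if_ n)).1.
- rewrite (hk _ if1).1; have := wcvg k Lk; apply: cvg_trans; apply: near_eq_cvg.
  by apply: nearW => n; rewrite (hk _ (if_ n)).1.
Qed.

End weak_L1_integral.

Section pairing_cvg.
Context {R : realType} {N : nat}.
Local Notation T := 'rV[R]_N.
Variable Om : set T.
Hypothesis Om_open : open Om.

(** An open relatively compact [D] around the support of [phi] is needed because weak convergence is
    local. Continuity of [phi] and of its first partial derivatives makes them bounded Borel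
    functions vanishing off [D], which is all that a test requires. *)
Lemma pairing_cvg (A : set T -> 'rV[R]_N) (dA : set T -> R) (lam : T -> R)
    (u_ : nat -> T -> R) (u : T -> R) (phi : T -> R) :
  radon_loc_vec Om A -> radon_loc Om dA ->
  (forall n, Xloc Om A dA lam (u_ n)) -> Xloc Om A dA lam u ->
  A_lambda_cvg Om A dA lam u_ u -> Cck 1 Om phi ->
  (fun n => pairing Om A dA lam (u_ n) phi) @ \oo --> pairing Om A dA lam u phi.
Proof.
move=> rA rdA Xu_ Xu [cvA cvdA] [[cphi dphi] [csupp suppOm]].
have [D [oD KD DOm]] := compact_open_between Om_open csupp suppOm.
have mD := open_measurable_rV oD.
have DsOm := compactly_inside_subset DOm.
have vanish (f : T -> R) : (forall x, ~ closure [set y | phi y != 0] x -> f x = 0) ->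
    forall x, ~ D x -> f x = 0.
  by move=> f0 x nD; apply: f0 => /KD.
have bound (f : T -> R) : continuous f ->
    (forall x, ~ closure [set y | phi y != 0] x -> f x = 0) ->
    exists M, forall x, `|f x| <= M.
  move=> cf f0; have [M hM] := continuous_compact_bounded cf csupp.
  exists (Num.max M 0) => x; rewrite le_max.
  have [Kx|Kx] := pselect (closure [set y | phi y != 0] x); first by rewrite hM.
  by rewrite f0// normr0 lexx orbT.
have phi0 x : ~ closure [set y | phi y != 0] x -> phi x = 0.
  move=> nx; apply/eqP; apply: contrapT => /negP h; apply: nx.
  exact: subset_closure.
have [mdA hdA] := tv_measure Om_open rdA.
have [mA hA] := tv_vec_measure Om_open rA.
have tvD : (tv Om dA D < +oo)%E.
  by apply: tv_finite => //; exact: radon_loc_dominated rdA DOm.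
have tvvD : (tv_vec Om A D < +oo)%E.
  by apply: tv_vec_finite => // i; exact: radon_loc_dominated (rA i) DOm.
rewrite /pairing; apply: cvgB.
  apply: cvgN; apply: (signed_integral_weak_cvg rdA hdA _ mD) => //.
  - move=> E mE; split; first exact: upper_variation_le_tv.
    by rewrite tv_upper_variation// leeDr// upper_variation_ge0.
  - exact: continuous_measurable_rV.
  - exact: bound.
  - exact: vanish.
  - by move=> n; have [_ _] := Xu_ n; apply.
  - by have [_ _] := Xu; apply.
  - exact: cvdA.
apply: cvg_big => [|i _]; first exact: add_continuous.
have supp0 x : ~ closure [set y | phi y != 0] x -> partial i phi x = 0.
  exact: support_compl_derive.
apply: (signed_integral_weak_cvg (rA i) hA _ mD) => //.
- by move=> E mE; exact: upper_variation_le_tv_vec.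
- by apply: continuous_measurable_rV; exact: (dphi i).2.
- by apply: bound => //; exact: (dphi i).2.
- exact: vanish.
- by move=> n; have [_ h _] := Xu_ n; apply: h.
- by have [_ h _] := Xu; apply: h.
- exact: cvA.
Qed.

End pairing_cvg.

(** * Smooth bump functions *)

Section flat_function.
Context {R : realType}.

(** [flat 0] is the classical exp(-1/x), extended by 0. The power x^-n closes the family under
    differentiation: the derivative of [flat n] combines [flat n.+1] and [flat n.+2]. *)
Definition flat (n : nat) (x : R) : R :=
  if 0 < x then x ^- n * expR (- x^-1) else 0.

Lemma flat_eq0 n x : x <= 0 -> flat n x = 0.
Proof. by rewrite /flat leNgt => /negPf->. Qed.

Lemma flat_gt0 n x : 0 < x -> 0 < flat n x.
Proof. by move=> x0; rewrite /flat x0 mulr_gt0 ?expR_gt0// invr_gt0 exprn_gt0. Qed.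

Lemma flat_ge0 n x : 0 <= flat n x.
Proof.
by have [x0|x0] := leP x 0; [rewrite flat_eq0|exact/ltW/flat_gt0].
Qed.

(** With y = 1/x this is y^(n+1)/(n+1)! <= e^y. The linear bound makes the difference quotients at 0
    vanish. *)
Lemma flat_le n x : 0 <= x -> flat n x <= (n.+1)`!%:R * x.
Proof.
rewrite le_eqVlt => /predU1P[<-|x0]; first by rewrite flat_eq0// mulr0.
have y0 : 0 < x^-1 by rewrite invr_gt0.
have f0 : 0 < (n.+1)`!%:R :> R by rewrite ltr0n fact_gt0.
have := expR_ge1Dxn n (ltW y0) => h.
rewrite /flat x0 expRN ler_pdivrMr ?expR_gt0//.
apply: (@le_trans _ _ ((n.+1)`!%:R * x * (x^-1 ^+ n.+1 / (n.+1)`!%:R))).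
  rewrite -exprVn exprS [leRHS](_ : _ = x^-1 ^+ n)//.
  by field; rewrite gt_eqF//= gt_eqF.
rewrite ler_wpM2l ?mulr_ge0 ?(ltW x0) ?(ltW f0)//.
by apply: le_trans h; rewrite lerDr.
Qed.

Lemma is_derive_flat (n : nat) (x : R) :
  is_derive x (1 : R) (flat n) (flat n.+2 x - n%:R * flat n.+1 x).
Proof.
have [x0|x0|->] := ltgtP x 0.
- rewrite !flat_eq0 ?ltW// mulr0 subr0.
  apply: (near_eq_is_derive (f := cst 0)).
  near=> y; rewrite flat_eq0//; apply/ltW; near: y; exact: lt_nbhsl.
- apply: (near_eq_is_derive
    (f := (fun y => y^-1) ^+ n * (expR \o (fun y : R => - y^-1)))).
    near=> y.
    have y0 : 0 < y by near: y; exact: lt_nbhsr.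
    by rewrite /flat y0 fctE/= exprfctE exprVn.
  have dV : is_derive x (1 : R) (fun y : R => y^-1) (- x ^- 2).
    apply: is_derive_eq; first by apply: (@is_deriveV _ id); rewrite gt_eqF.
    by rewrite scaler1.
  have dE : is_derive x (1 : R) (expR \o (fun y : R => - y^-1)) (expR (- x^-1) * x ^- 2).
    rewrite -[x ^- 2]opprK; exact: is_derive1_comp.
  apply: is_derive_eq.
  rewrite /flat x0 /GRing.scale/= exprfctE.
  case: n => [|n]; first by rewrite !mul0r mulr0 addr0 subr0 expr0 mul1r mulrC.
  rewrite /= -!exprVn !exprS; by move: (x^-1) (expR _) (n.+1%:R) => y E m; ring.
- rewrite !(@flat_eq0 _ 0)// mulr0 subr0.
  have L : (fun h : R => h^-1 *: ((flat n \o shift 0) (h *: 1) - flat n 0))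
      @ 0^' --> (0 : R).
    apply/cvgr0Pnorm_lt => e e0.
    have f0 : 0 < (n.+2)`!%:R :> R by rewrite ltr0n fact_gt0.
    (* For h > 0 the difference quotient of [flat n] at 0 is [flat n.+1 h], at most (n+2)! h by
       [flat_le]. *)
    exists (e / (n.+2)`!%:R) => /=; first by rewrite /= divr_gt0.
    move=> h /=; rewrite sub0r normrN => he h0.
    rewrite addr0 [h *: 1]mulr1 (@flat_eq0 _ 0)// subr0.
    have [hle|hgt] := leP h 0; first by rewrite flat_eq0// scaler0 normr0.
    have -> : h^-1 *: flat n h = flat n.+1 h.
      by rewrite /flat hgt /GRing.scale/= mulrA -invfM exprS.
    rewrite ger0_norm ?flat_ge0//; apply: le_lt_trans (flat_le _ (ltW hgt)) _.
    by move: he; rewrite gtr0_norm// ltr_pdivlMr// mulrC.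
  apply: DeriveDef; first by apply/cvg_ex; exists 0.
  exact: cvg_lim L.
Unshelve. all: by end_near. Qed.

Lemma continuous_flat n : continuous (flat n).
Proof.
move=> x; apply: differentiable_continuous; apply/derivable1_diffP.
by apply: ex_derive; exact: is_derive_flat.
Qed.

Lemma is_derive_affine (a b x : R) : is_derive x (1 : R) (fun h => a * h + b) a.
Proof.
rewrite (_ : (fun h => _) = (a \*: (@id R) : R -> R) + cst b)//.
by apply: is_derive_eq; rewrite addr0 [_ *: _]mulr1.
Qed.

End flat_function.

(** * Calculus of C^k functions and construction of bumps *)

Section smooth_functions.
Context {R : realType} {N : nat}.
Local Notation T := 'rV[R]_N.
Implicit Types (f g : T -> R) (k : nat).

Lemma is_derive_line f (a v : T) (df : R) :
  is_derive (0 : R) 1 (fun h : R => f (h *: v + a)) df -> is_derive a v f df.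
Proof.
move=> [d1 d2]; have d : derivable f a v by apply/derivable1P.
apply: DeriveDef => //; rewrite -d2 /derive.
match goal with |- lim (?F @ _) = lim (?G @ _) => suff -> : F = G by [] end.
apply/funext => h /=.
by rewrite addr0 [h *: 1]mulr1 scale0r add0r.
Qed.

(** Reduces a C^k claim to naming candidate partial derivatives, which suits induction on [k]. *)
Lemma Ck_is_derive k f (df : 'I_N -> T -> R) : continuous f ->
  (forall i x, is_derive x (delta_mx 0 i : T) f (df i x)) ->
  (forall i, Ck k (df i)) -> Ck k.+1 f.
Proof.
move=> cf dfE Cdf; split=> // i; split; first by move=> x; case: (dfE i x).
suff -> : partial i f = df i by exact: Cdf.
by apply/funext => x; have [] := dfE i x.
Qed.

Lemma Ck_continuous k f : Ck k f -> continuous f.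
Proof. by case: k => [|k] //= []. Qed.

Lemma Ck_derivable k f i x : Ck k.+1 f -> derivable f x (delta_mx 0 i : T).
Proof. by move=> [_ /(_ i)[]]. Qed.

Lemma Ck_partial k f i : Ck k.+1 f -> Ck k (partial i f).
Proof. by move=> [_ /(_ i)[]]. Qed.

Lemma CkS k f : Ck k.+1 f -> Ck k f.
Proof.
elim: k f => [|k IH] f; first by move=> [].
by move=> [cf hf]; split=> // i; have [? ?] := hf i; split=> //; exact: IH.
Qed.

Lemma Ck_cst k (c : R) : Ck k (cst c : T -> R).
Proof.
elim: k c => [|k IH] c; first exact: cst_continuous.
apply: (@Ck_is_derive _ _ (fun _ => cst 0)) => //; first exact: cst_continuous.
Qed.

Lemma CkD k f g : Ck k f -> Ck k g -> Ck k (f \+ g).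
Proof.
elim: k f g => [|k IH] f g Cf Cg; first by move=> x; exact: (cvgD (Cf x) (Cg x)).
apply: (@Ck_is_derive _ _ (fun i => partial i f \+ partial i g)).
- have cf := Ck_continuous Cf; have cg := Ck_continuous Cg.
  by move=> x; exact: (cvgD (cf x) (cg x)).
- move=> i x; have /derivableP df : derivable f x (delta_mx 0 i : T) by exact: Ck_derivable Cf.
  have /derivableP dg : derivable g x (delta_mx 0 i : T) by exact: Ck_derivable Cg.
  exact: is_deriveD.
- by move=> i; apply: IH; exact: Ck_partial.
Qed.

Lemma CkM k f g : Ck k f -> Ck k g -> Ck k (f \* g).
Proof.
elim: k f g => [|k IH] f g Cf Cg; first by move=> x; exact: (cvgM (Cf x) (Cg x)).
apply: (@Ck_is_derive _ _ (fun i => (f \* partial i g) \+ (g \* partial i f))).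
- have cf := Ck_continuous Cf; have cg := Ck_continuous Cg.
  by move=> x; exact: (cvgM (cf x) (cg x)).
- move=> i x; have /derivableP df : derivable f x (delta_mx 0 i : T) by exact: Ck_derivable Cf.
  have /derivableP dg : derivable g x (delta_mx 0 i : T) by exact: Ck_derivable Cg.
  exact: is_deriveM.
- move=> i; apply: CkD; apply: IH.
  + exact: CkS.
  + exact: (Ck_partial _ Cg).
  + exact: CkS.
  + exact: (Ck_partial _ Cf).
Qed.

Lemma CkV k f : (forall x, f x != 0) -> Ck k f -> Ck k (fun x => (f x)^-1).
Proof.
move=> f0; elim: k => [|k IH] Cf.
  by move=> x; exact: (cvgV (f0 x) (Cf x)).
have CV := IH (CkS Cf).
apply: (@Ck_is_derive _ _ (fun i => (cst (-1) \* (fun x => (f x)^-1)) \*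
    ((fun x => (f x)^-1) \* partial i f))).
- have cf := Ck_continuous Cf.
  by move=> x; exact: (cvgV (f0 x) (cf x)).
- move=> i x; have df : derivable f x (delta_mx 0 i : T) by exact: Ck_derivable Cf.
  apply: DeriveDef; first exact: derivableV.
  by rewrite deriveV//= /GRing.scale/= expr2 invfM; rewrite /partial; ring.
- move=> i; apply: CkM; first by apply: CkM => //; exact: Ck_cst.
  by apply: CkM => //; exact: Ck_partial.
Qed.

Lemma Ck_sum k (I : Type) (r : seq I) (F : I -> T -> R) :
  (forall i, Ck k (F i)) -> Ck k (fun x => \sum_(i <- r) F i x).
Proof.
move=> CF; elim: r => [|i r IH].
  rewrite (_ : (fun _ => _) = cst 0); first exact: Ck_cst.
  by apply/funext => x; rewrite big_nil.
rewrite (_ : (fun _ => _) = F i \+ (fun x => \sum_(i <- r) F i x)); first exact: CkD.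
by apply/funext => x; rewrite big_cons.
Qed.

Lemma Ck_prod k (I : Type) (r : seq I) (F : I -> T -> R) :
  (forall i, Ck k (F i)) -> Ck k (fun x => \prod_(i <- r) F i x).
Proof.
move=> CF; elim: r => [|i r IH].
  rewrite (_ : (fun _ => _) = cst 1); first exact: Ck_cst.
  by apply/funext => x; rewrite big_nil.
rewrite (_ : (fun _ => _) = F i \* (fun x => \prod_(i <- r) F i x)); first exact: CkM.
by apply/funext => x; rewrite big_cons.
Qed.

(** The induction on [k] treats all [n] at once, since differentiation raises [n] by one and by
    two. *)
Lemma Ck_flat k n (s c : R) (i : 'I_N) : Ck k (fun x : T => flat n (s * x 0 i + c)).
Proof.
have caff : continuous (fun x : T => s * x 0 i + c).
  move=> x; have cx : (fun y : T => y 0 i) @ x --> x 0 i by exact: coord_continuous.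
  exact: (cvgD (cvgM (cvg_cst s) cx) (cvg_cst c)).
have cflat m : continuous (fun x : T => flat m (s * x 0 i + c)).
  by move=> x; exact: (continuous_comp (caff x) (@continuous_flat _ m _)).
elim: k n => [|k IH] n; first exact: cflat.
pose df (j : 'I_N) (x : T) := (s * (i == j)%:R) *
  (flat n.+2 (s * x 0 i + c) + (- n%:R) * flat n.+1 (s * x 0 i + c)).
apply: (@Ck_is_derive _ _ df) => //.
- move=> j x; apply: is_derive_line.
  rewrite (_ : (fun h : R => _) = flat n \o
      (fun h : R => (s * (i == j)%:R) * h + (s * x 0 i + c))); last first.
    by apply/funext => h /=; congr (flat n _); rewrite !mxE eqxx/=; ring.
  rewrite /df [in X in is_derive _ _ _ X]mulrC; apply: is_derive1_comp.
    by rewrite mulr0 add0r mulNr; exact: is_derive_flat.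
  exact: is_derive_affine.
- move=> j; apply: CkM; first exact: Ck_cst.
  by apply: CkD => //; apply: CkM => //; exact: Ck_cst.
Qed.

(** For r > 0 it is positive exactly on the sup norm ball: in each coordinate one factor lives on
    x_i > a_i - r, the other on x_i < a_i + r. The multipliers [1] and [- 1] match the form of
    [Ck_flat]. *)
Definition bump (a : T) (r : R) (x : T) : R :=
  \prod_(i < N) (flat 0 (1 * x 0 i + (r - a 0 i)) * flat 0 (- 1 * x 0 i + (r + a 0 i))).

Lemma Ck_bump k a r : Ck k (bump a r).
Proof. by apply: Ck_prod => i; apply: CkM; exact: Ck_flat. Qed.

Lemma bump_ge0 a r x : 0 <= bump a r x.
Proof. by apply: prodr_ge0 => i _; rewrite mulr_ge0// flat_ge0. Qed.

Lemma bump_gt0 a r x : 0 < r -> ball a r x -> 0 < bump a r x.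
Proof.
move=> r0 /ball_rVE => /(_ r0) ax; apply: prodr_gt0 => i _.
by have := ax i; rewrite ltr_norml => /andP[? ?]; rewrite mulr_gt0// flat_gt0//; lra.
Qed.

Lemma bump_eq0 a r x : 0 < r -> ~ ball a r x -> bump a r x = 0.
Proof.
move=> r0 /ball_rVE => /(_ r0) /existsNP[i /negP]; rewrite -leNgt => h.
rewrite /bump (bigD1 i)//=.
suff -> : flat 0 (1 * x 0 i + (r - a 0 i)) * flat 0 (- 1 * x 0 i + (r + a 0 i)) = 0.
  by rewrite mul0r.
have [h1|h1] := leP (1 * x 0 i + (r - a 0 i)) 0; first by rewrite flat_eq0 ?mul0r.
rewrite [X in _ * X]flat_eq0 ?mulr0//; move: h; rewrite ler_normr => /orP[]; lra.
Qed.

Lemma CcinftyMr Om f g : Ccinfty Om f -> (forall k, Ck k g) -> Ccinfty Om (f \* g).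
Proof.
move=> Cf Cg k; split; first by apply: CkM => //; exact: (Cf k).1.
by apply: compactly_inside_sub (Cf 0%N).2 => x /=; apply: contra_neq => ->; rewrite mul0r.
Qed.

Lemma CcinftyD Om f g : Ccinfty Om f -> Ccinfty Om g -> Ccinfty Om (f \+ g).
Proof.
move=> Cf Cg k; split; first by apply: CkD; [exact: (Cf k).1|exact: (Cg k).1].
apply: compactly_inside_sub (compactly_insideU (Cf 0%N).2 (Cg 0%N).2) => x /=.
have [f0|f0] := eqVneq (f x) 0; last by left.
by rewrite f0 add0r; right.
Qed.

Lemma Ccinfty0 Om : Ccinfty Om (cst 0 : T -> R).
Proof.
move=> k; split; first exact: Ck_cst.
rewrite (_ : [set x | _] = set0); first exact: compactly_inside0.
by apply/seteqP; split => // x /=; rewrite eqxx.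
Qed.

Lemma Ccinfty_sum Om (I : eqType) (r : seq I) (F : I -> T -> R) :
  (forall i, i \in r -> Ccinfty Om (F i)) ->
  Ccinfty Om (fun x => \sum_(i <- r) F i x).
Proof.
elim: r => [_|i r IH CF].
  rewrite (_ : (fun _ => _) = cst 0); first exact: Ccinfty0.
  by apply/funext => x; rewrite big_nil.
rewrite (_ : (fun _ => _) = F i \+ (fun x => \sum_(i <- r) F i x)).
  apply: CcinftyD; first by apply: CF; rewrite mem_head.
  by apply: IH => j jr; apply: CF; rewrite in_cons jr orbT.
by apply/funext => x; rewrite big_cons.
Qed.

Lemma Ccinfty_bump Om a r : 0 < r -> compactly_inside (ball a r) Om ->
  Ccinfty Om (bump a r).
Proof.
move=> r0 cB k; split; first exact: Ck_bump.
apply: compactly_inside_sub cB => x /=; apply: contraPP => /(bump_eq0 r0) ->.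
by apply/negP; rewrite eqxx.
Qed.

End smooth_functions.

(** * Approximation of Borel sets by smooth functions *)

Section smooth_approximation.
Context {R : realType} {N : nat}.
Local Notation T := 'rV[R]_N.
Variables (Om : set T) (m : {measure set T -> \bar R}).
Hypotheses (Om_open : open Om) (mOm : (m Om < +oo)%E).

Lemma integrable_of_bounded (f : T -> R) (M : R) : measurable_fun setT f ->
  (forall x, `|f x| <= M) -> m.-integrable Om (EFin \o f).
Proof.
move=> mf fM; apply: measurable_bounded_integrable => //.
- exact: open_measurable_rV.
- exact: measurable_funTS.
- exists M; split; first exact: num_real.
  by move=> y My x _ /=; apply: le_trans (fM x) (ltW My).
Qed.

Lemma Ccinfty_continuous (psi : T -> R) : Ccinfty Om psi -> continuous psi.
Proof. by move=> /(_ 0%N)[]. Qed.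

Lemma Ccinfty_measurable (psi : T -> R) : Ccinfty Om psi -> measurable_fun setT psi.
Proof. by move=> /Ccinfty_continuous; exact: continuous_measurable_rV. Qed.

Definition approximable (B : set T) := forall e : R, 0 < e ->
  exists psi, [/\ Ccinfty Om psi, forall x, 0 <= psi x <= 1 &
    \int[m]_(x in Om) `|\1_B x - psi x| < e].

Lemma indic01 (B : set T) x : 0 <= (\1_B x : R) <= 1.
Proof. by rewrite indicE; case: (x \in B); rewrite ?lexx ?ler01. Qed.

Let mOm' : measurable Om. Proof. exact: open_measurable_rV. Qed.

Lemma integrable_dist (B : set T) (f : T -> R) : measurable B ->
  measurable_fun setT f -> (forall x, 0 <= f x <= 1) ->
  m.-integrable Om (EFin \o (fun x => `|\1_B x - f x|)).
Proof.
move=> mB mf f01; apply: (@integrable_of_bounded _ 1).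
  apply: measurableT_comp => //; apply: measurable_funB => //.
move=> x; rewrite normr_id; have /andP[? ?] := indic01 B x.
by have /andP[? ?] := f01 x; rewrite ler_norml; lra.
Qed.

Lemma dist_le_add (B B1 B2 : set T) (f f1 f2 : T -> R) :
  measurable B -> measurable B1 -> measurable B2 ->
  measurable_fun setT f -> measurable_fun setT f1 -> measurable_fun setT f2 ->
  (forall x, 0 <= f x <= 1) -> (forall x, 0 <= f1 x <= 1) -> (forall x, 0 <= f2 x <= 1) ->
  (forall x, Om x -> `|\1_B x - f x| <= `|\1_B1 x - f1 x| + `|\1_B2 x - f2 x|) ->
  \int[m]_(x in Om) `|\1_B x - f x| <=
  \int[m]_(x in Om) `|\1_B1 x - f1 x| + \int[m]_(x in Om) `|\1_B2 x - f2 x|.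
Proof.
move=> mB mB1 mB2 mf mf1 mf2 f01 f101 f201 h.
have i1 := integrable_dist mB1 mf1 f101; have i2 := integrable_dist mB2 mf2 f201.
rewrite -RintegralD//; apply: le_Rintegral => //; first exact: integrable_dist.
exact: (integrableD mOm' i1 i2).
Qed.

(** Dominated convergence: the constant 1 is an integrable bound because [m] is finite on [Om]. *)
Lemma dist_cvg0 (B : set T) (f_ : nat -> T -> R) (e : R) : 0 < e -> measurable B ->
  (forall n, measurable_fun setT (f_ n)) -> (forall n x, 0 <= f_ n x <= 1) ->
  (forall x, (fun n => f_ n x) @ \oo --> (\1_B x : R)) ->
  exists n, \int[m]_(x in Om) `|\1_B x - f_ n x| < e.
Proof.
move=> e0 mB mf f01 fB.
have : (fun n => \int[m]_(x in Om) `|\1_B x - f_ n x|) @ \oo --> (0 : R).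
  have -> : (0 : R) = fine (\int[m]_(x in Om) (0 : R)%:E)%E by rewrite integral0.
  apply: fine_cvg; rewrite fineK ?integral0//.
  have -> : (0 = \int[m]_(x in Om) (0 : R)%:E)%E by rewrite integral0.
  apply: (@dominated_cvg _ _ _ m Om mOm' _ _ (cst 1%E)) => //.
  - by move=> n; apply: measurable_int (integrable_dist mB (mf n) (f01 n)).
  - move=> x _; apply: cvg_EFin; first exact: nearW.
    rewrite -[X in _ --> X](normr0 R) -[X in `|X|](subrr (\1_B x : R)).
    apply: cvg_norm; apply: cvgB; [exact: cvg_cst|exact: fB].
  - by apply: (@integrable_of_bounded (cst 1) 1) => // x; rewrite normr1.
  - move=> n x _; rewrite abse_EFin lee_fin normr_id.
    have /andP[? ?] := indic01 B x.
    by have /andP[? ?] := f01 n x; rewrite ler_norml; lra.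
move=> /cvgr0Pnorm_lt => /(_ e e0)[n _ hn]; exists n.
by apply: le_lt_trans (ler_norm _) (hn n _); rewrite /= leqnn.
Qed.

Lemma approximable0 : approximable set0.
Proof.
move=> e e0; exists (cst 0); split.
- exact: Ccinfty0.
- by move=> x; rewrite lexx ler01.
- rewrite (_ : (fun x => _) = cst 0) ?Rintegral_cst ?mul0r//.
  by apply/funext => x; rewrite indic0 subr0 normr0.
Qed.

Lemma approximable_ball (a : T) (r : R) : 0 < r ->
  compactly_inside (ball a r) Om -> approximable (ball a r).
Proof.
move=> r0 cB e e0.
pose psi (n : nat) (x : T) := bump a r x / (bump a r x + n.+1%:R^-1).
have d0 n x : 0 < bump a r x + n.+1%:R^-1.
  by rewrite ltr_wpDl ?bump_ge0// invr_gt0.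
have Cpsi n : Ccinfty Om (psi n).
  apply: CcinftyMr => [|k]; first exact: Ccinfty_bump.
  apply: CkV; first by move=> x; rewrite gt_eqF.
  by apply: CkD; [exact: Ck_bump|exact: Ck_cst].
have psi01 n x : 0 <= psi n x <= 1.
  rewrite /psi divr_ge0 ?bump_ge0 ?(ltW (d0 _ _))//= ler_pdivrMr// mul1r.
  by rewrite lerDl.
have mball : measurable (ball a r) by apply: open_measurable_rV; exact: ball_open.
have [|n hn] := dist_cvg0 e0 mball (fun n => Ccinfty_measurable (Cpsi n)) psi01.
  move=> x; rewrite indicE.
  have [xB|xB] := pselect (ball a r x).
    rewrite mem_set//= /psi; have b0 := bump_gt0 r0 xB.
    rewrite -[X in _ --> X](@divff _ (bump a r x)) ?gt_eqF//; apply: cvgM; first exact: cvg_cst.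
    apply: cvgV; first by rewrite gt_eqF.
    rewrite -[X in _ --> X]addr0.
    have ch : (fun n => n.+1%:R^-1 : R) @ \oo --> (0 : R) by exact: cvg_harmonic.
    exact: (cvgD (cvg_cst _) ch).
  rewrite memNset//=; rewrite (_ : (fun n => _) = cst 0); first exact: cvg_cst.
  by apply/funext => n; rewrite /psi bump_eq0// mul0r.
by exists (psi n); split.
Qed.

(** f + g - fg = 1 - (1 - f)(1 - g) is smooth, unlike a maximum, and has the same form as the
    indicator of a union. The error then splits into the two given errors, each times a factor in
    [0, 1]. *)
Lemma approximableU (B C : set T) : measurable B -> measurable C ->
  approximable B -> approximable C -> approximable (B `|` C).
Proof.
move=> mB mC aB aC e e0; have e20 : 0 < e / 2 by rewrite divr_gt0.
have [f [Cf f01 hf]] := aB _ e20; have [g [Cg g01 hg]] := aC _ e20.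
pose h := (f \+ g) \+ (cst (-1) \* (f \* g)).
have hE x : h x = 1 - (1 - f x) * (1 - g x) by rewrite /h/=; ring.
have Ch : Ccinfty Om h.
  apply: CcinftyD; first exact: CcinftyD.
  have -> : cst (-1) \* (f \* g) = f \* (g \* cst (-1)).
    by apply/funext => x /=; rewrite mulrC mulrA.
  by apply: CcinftyMr => // k; apply: CkM; [exact: (Cg k).1|exact: Ck_cst].
have h01 x : 0 <= h x <= 1.
  rewrite hE; have /andP[? ?] := f01 x; have /andP[? ?] := g01 x.
  by apply/andP; split; nra.
exists h; split => //.
rewrite [e]splitr; apply: le_lt_trans (ltrD hf hg).
apply: dist_le_add => //; [exact: measurableU|exact: Ccinfty_measurable..|].
move=> x _.
have -> : (\1_(B `|` C) x : R) = 1 - (1 - \1_B x) * (1 - \1_C x).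
  rewrite !indicE in_setU; case: (x \in B); case: (x \in C) => /=; ring.
rewrite hE [X in `|X|](_ : _ = (\1_B x - f x) * (1 - \1_C x) +
  (\1_C x - g x) * (1 - f x)); last by ring.
apply: le_trans (ler_normD _ _) _; rewrite !normrM; apply: lerD; apply: ler_piMr => //.
  by have /andP[? ?] := indic01 C x; rewrite ler_norml; lra.
by have /andP[? ?] := f01 x; rewrite ler_norml; lra.
Qed.

(** The indicators of finite unions converge pointwise; half of [e] pays for truncating the union,
    half for smoothing the finite union. *)
Lemma approximable_bigcup (F : nat -> set T) : (forall n, measurable (F n)) ->
  (forall n, approximable (F n)) -> approximable (\bigcup_n F n).
Proof.
move=> mF aF.
pose G n := \bigcup_(i < n) F i.
have mG n : measurable (G n) by exact: bigcup_measurable.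
have aG n : approximable (G n).
  elim: n => [|n IH]; rewrite /G.
    by rewrite bigcup_mkord big_ord0; exact: approximable0.
  rewrite bigcup_mkord big_ord_recr/= -bigcup_mkord.
  exact: (approximableU (mG n) (mF n) IH (aF n)).
move=> e e0; have e20 : 0 < e / 2 by rewrite divr_gt0.
have mU : measurable (\bigcup_n F n) by exact: bigcupT_measurable.
have [x|n hn] := @dist_cvg0 _ (fun n => \1_(G n)) _ e20 mU
    (fun n => measurable_indic (mG n)) (fun n => indic01 (G n)).
  rewrite [X in _ --> X]indicE.
  have [[k _ Fk]|xU] := pselect ((\bigcup_n F n) x).
    rewrite mem_set; last by exists k.
    apply: cvg_near_cst; exists k.+1 => // n /= kn.
    by rewrite indicE mem_set//; exists k.
  rewrite memNset//; apply: cvg_near_cst; apply: nearW => n.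
  by rewrite indicE memNset// => -[k _ Fk]; apply: xU; exists k.
have [psi [Cpsi psi01 hpsi]] := aG n _ e20.
exists psi; split => //; rewrite [e]splitr; apply: le_lt_trans (ltrD hn hpsi).
apply: dist_le_add => //; try solve
  [exact: Ccinfty_measurable|exact: measurable_indic|by move=> x; exact: indic01].
by move=> x _; rewrite -[X in `|X|](subrKA (\1_(G n) x)); exact: ler_normD.
Qed.

Lemma approximable_open (U : set T) : open U -> U `<=` Om -> approximable U.
Proof.
move=> oU UOm; have [F [UF hF]] := open_bigcup_ball oU.
rewrite UF; apply: approximable_bigcup => n.
  have [->|[a [r [r0 -> _]]]] := hF n; first exact: measurable0.
  by apply: open_measurable_rV; exact: ball_open.
have [->|[a [r [r0 -> cB]]]] := hF n; first exact: approximable0.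
exact: (approximable_ball r0 (compactly_inside_subr UOm cB)).
Qed.

(** The generating open sets of the Borel sigma-algebra may leave [Om]; this allows them to be
    replaced by their traces. *)
Lemma approximable_eqI (B C : set T) : B `&` Om = C `&` Om ->
  approximable B -> approximable C.
Proof.
move=> BC aB e e0; have [psi [Cpsi psi01 hpsi]] := aB e e0.
exists psi; split => //; rewrite (@eq_Rintegral _ _ _ m Om (fun x => `|\1_B x - psi x|))//.
move=> x; rewrite inE => Ox; congr (`|_ - _|); rewrite !indicE; congr (_%:R).
apply: congr1; apply/idP/idP; rewrite !inE => Bx.
  by have : (B `&` Om) x by [rewrite BC]; case.
by have : (C `&` Om) x by [rewrite -BC]; case.
Qed.

(** 1 - f need not have compact support in [Om], so it is multiplied by a smooth approximation [g]
    of the indicator of [Om]. *)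
Lemma approximableC (B : set T) : measurable B -> approximable B -> approximable (~` B).
Proof.
move=> mB aB e e0; have e20 : 0 < e / 2 by rewrite divr_gt0.
have [f [Cf f01 hf]] := aB _ e20.
have [g [Cg g01 hg]] := approximable_open Om_open (@subset_refl _ _) e20.
pose h := g \* (cst 1 \+ (cst (-1) \* f)).
have hE x : h x = g x * (1 - f x) by rewrite /h/=; ring.
have Ch : Ccinfty Om h.
  apply: CcinftyMr => // k; apply: CkD; first exact: Ck_cst.
  by apply: CkM; [exact: Ck_cst|exact: (Cf k).1].
have h01 x : 0 <= h x <= 1.
  rewrite hE; have /andP[? ?] := f01 x; have /andP[? ?] := g01 x.
  by apply/andP; split; nra.
exists h; split => //; rewrite [e]splitr; apply: le_lt_trans (ltrD hf hg).
apply: dist_le_add => //; [exact: measurableC|exact: Ccinfty_measurable..|].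
move=> x Ox; have -> : (\1_(~` B) x : R) = 1 - \1_B x.
  by rewrite !indicE in_setC; case: (x \in B); rewrite ?subrr ?subr0.
have -> : (\1_Om x : R) = 1 by rewrite indicE mem_set.
rewrite hE [X in `|X|](_ : _ = (f x - \1_B x) + (1 - g x) * (1 - f x)); last by ring.
apply: le_trans (ler_normD _ _) _; rewrite distrC lerD2l normrM; apply: ler_piMr => //.
by have /andP[? ?] := f01 x; rewrite ler_norml; lra.
Qed.

Lemma measurable_approximable (B : set T) : measurable B -> approximable B.
Proof.
move=> mB; suff [] : measurable B /\ approximable B by [].
pose G : set (set T) := [set C | measurable C /\ approximable C].
have : sigma_algebra setT G.
  split.
  - by split; [exact: measurable0|exact: approximable0].
  - move=> C [mC aC]; rewrite setTD; split; first exact: measurableC.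
    exact: approximableC.
  - move=> F GF; split; first by apply: bigcupT_measurable => n; exact: (GF n).1.
    by apply: approximable_bigcup => n; [exact: (GF n).1|exact: (GF n).2].
move=> /smallest_sub/(_ _ B mB); apply => U oU; split; first exact: open_measurable_rV.
apply: (@approximable_eqI (U `&` Om)); first by rewrite -setIA setIid.
by apply: approximable_open; [exact: openI|exact: subIsetr].
Qed.

End smooth_approximation.

(** * Finite Radon measures tested against smooth functions *)

Section uniform_approximation.
Context {R : realType} {N : nat}.
Local Notation T := 'rV[R]_N.
Variable Om : set T.
Hypothesis Om_open : open Om.

(** The image S(K) is closed and misses 0, so a ball around 0 misses it too; an empty [K] needs no
    separate case. *)
Lemma positive_continuous_compact (S : T -> R) (K : set T) : continuous S ->
  compact K -> (forall x, K x -> 0 < S x) ->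
  exists2 s, 0 < s & forall x, K x -> s <= S x.
Proof.
move=> cS cK S0.
have clSK : closed (S @` K).
  apply: compact_closed; first exact: norm_hausdorff.
  by apply: continuous_compact => //; exact: continuous_subspaceT.
have : nbhs (0 : R) (~` (S @` K)).
  apply: open_nbhs_nbhs; split; first exact: closed_openC.
  by move=> [x Kx Sx]; have := S0 x Kx; rewrite Sx ltxx.
move=> /nbhs_ballP[s /= s0 hs]; exists s => // x Kx.
rewrite leNgt; apply/negP => Sxs; apply: (hs (S x)); last by exists x.
by rewrite /ball/= sub0r normrN gtr0_norm// S0.
Qed.

(* The approximant is sum_j phi(x_j) B_j / (sum_j B_j + c) for bumps B_j supported
   in small balls around x_j that cover the support of phi; the constant c > 0
   keeps the denominator positive. *)
Lemma Cc_uniform_approx (phi : T -> R) (e : R) : Cck 0 Om phi -> 0 < e ->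
  exists2 psi, Ccinfty Om psi & forall x, `|phi x - psi x| <= e.
Proof.
move=> [cphi [cK KOm]] e0; set K := closure _ in cK KOm.
have phi0 x : ~ K x -> phi x = 0.
  move=> nx; apply/eqP; apply: contrapT => /negP h; apply: nx.
  exact: subset_closure.
have e20 : 0 < e / 2 by rewrite divr_gt0.
have /choice[r hr] : forall x, exists r : R, K x -> [/\ 0 < r,
    compactly_inside (ball x r) Om & forall y, ball x r y -> `|phi y - phi x| <= e / 2].
  move=> x; have [Kx|nKx] := pselect (K x); last by exists 0.
  have /nbhs_ballP[r1 /= r10 h1] : nbhs x Om by apply: open_nbhs_nbhs; split => //; exact: KOm.
  have := cphi x; move=> /cvgrPdist_le/(_ _ e20)/nbhs_ballP[r2 /= r20 h2].
  exists (Num.min r1 r2 / 2) => _.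
  have r0 : 0 < Num.min r1 r2 by rewrite lt_min r10.
  split; first by rewrite divr_gt0.
    apply: (@ball_compactly_inside _ _ _ _ r1) => //; first by rewrite divr_gt0.
    rewrite ltr_pdivrMr//; apply: (@le_lt_trans _ _ r1); first by rewrite ge_min lexx.
    by rewrite ltr_pMr// ltr1n.
  move=> y xy; rewrite distrC; apply: h2; apply: le_ball xy.
  rewrite ler_pdivrMr//; apply: (@le_trans _ _ r2); first by rewrite ge_min lexx orbT.
  by rewrite ler_peMr ?ltW// ltr1n.
have := cK; rewrite compact_cover => /(_ _ K (fun x => ball x (r x))) [||G GK KG].
- by move=> x Kx; have [? _ _] := hr x Kx; exact: ball_open.
- by move=> x Kx; exists x => //; have [? _ _] := hr x Kx; exact: ballxx.
set s := finmap.enum_fset G in KG.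
have sK x : x \in s -> K x by move=> xs; have := GK x xs; rewrite inE.
pose S y := \sum_(x <- s) bump x (r x) y.
have CS k : Ck k S by apply: Ck_sum => x; exact: Ck_bump.
have S0 y : 0 <= S y by apply: sumr_ge0 => x _; exact: bump_ge0.
have [c0 c00 Sc0] : exists2 c0, 0 < c0 & forall x, K x -> c0 <= S x.
  apply: positive_continuous_compact => //; first exact: (Ck_continuous (CS 0%N)).
  move=> y /KG[x /= xs xy]; have [rx _ _] := hr x (sK x xs).
  rewrite /S (big_rem x)//=; apply: ltr_pwDl; first exact: bump_gt0.
  by apply: sumr_ge0 => z _; exact: bump_ge0.
have [M hM] := continuous_compact_bounded cphi cK.
have M1 : 0 < `|M| + 1 by rewrite ltr_wpDl.
(* Chosen so that c |phi| <= (e/2) c0 <= (e/2) S on the support of [phi], where S >= c0 and |phi| <=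
   M. *)
pose c := e / 2 * c0 / (`|M| + 1).
have c_gt0 : 0 < c by rewrite divr_gt0// mulr_gt0.
have Sc y : 0 < S y + c by rewrite ltr_wpDl.
pose psi y := \sum_(x <- s) (bump x (r x) \* (cst (phi x) \* (fun z => (S z + c)^-1))) y.
exists psi.
  apply: Ccinfty_sum => x xs; have [rx cB _] := hr x (sK x xs).
  apply: CcinftyMr => [|k]; first exact: Ccinfty_bump.
  apply: CkM; first exact: Ck_cst.
  apply: CkV => [y|]; first by rewrite gt_eqF.
  by apply: CkD => //; exact: Ck_cst.
move=> y.
(* In the numerator, the sum is at most (e/2) S because [phi] oscillates by at most e/2 on each
   ball, and c phi(y) is the price of the constant in the denominator. *)
have -> : phi y - psi y =
    (\sum_(x <- s) (phi y - phi x) * bump x (r x) y + c * phi y) / (S y + c).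
  have -> : psi y = (\sum_(x <- s) phi x * bump x (r x) y) / (S y + c).
    rewrite /psi mulr_suml; apply: eq_bigr => x _ /=; ring.
  have -> : \sum_(x <- s) (phi y - phi x) * bump x (r x) y =
      phi y * S y - \sum_(x <- s) phi x * bump x (r x) y.
    by rewrite /S mulr_sumr -sumrB; apply: eq_bigr => x _; rewrite mulrBl.
  by field; rewrite gt_eqF.
rewrite normrM normfV (gtr0_norm (Sc y)) ler_pdivrMr//.
apply: le_trans (ler_normD _ _) _.
have h1 : `|\sum_(x <- s) (phi y - phi x) * bump x (r x) y| <= e / 2 * S y.
  apply: le_trans (ler_norm_sum _ _ _) _.
  rewrite /S mulr_sumr big_seq [leRHS]big_seq; apply: ler_sum => x xs.
  have [rx _ hx] := hr x (sK x xs).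
  have [xy|xy] := pselect (ball x (r x) y).
    by rewrite normrM (ger0_norm (bump_ge0 _ _ _)) ler_wpM2r ?bump_ge0// hx.
  by rewrite bump_eq0// !mulr0 normr0.
have h2 : `|c * phi y| <= e / 2 * (S y + c).
  have [Ky|nKy] := pselect (K y); last first.
    by rewrite phi0// mulr0 normr0 mulr_ge0// ltW.
  rewrite normrM (gtr0_norm c_gt0); apply: (@le_trans _ _ (e / 2 * c0)).
    rewrite -[c * _]mulrA ler_piMr//; first by rewrite mulr_ge0// ltW.
    rewrite mulrC ler_pdivrMr// mul1r; apply: le_trans (hM y Ky) _.
    by apply: le_trans (ler_norm M) _; rewrite lerDl.
  by rewrite ler_pM2l//; apply: le_trans (Sc0 y Ky) _; rewrite lerDl ltW.
apply: le_trans (lerD h1 h2) _.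
have -> : e * (S y + c) = e / 2 * S y + e / 2 * (S y + c) + e / 2 * c by field.
by rewrite lerDl mulr_ge0// ltW.
Qed.

End uniform_approximation.

(** * Integration against a finite signed measure and its mass by duality *)

Section finite_radon_measure.
Context {R : realType} {N : nat}.
Local Notation T := 'rV[R]_N.
Variables (Om : set T) (mu : set T -> R).
Hypotheses (Om_open : open Om) (mu_fin : radon_fin Om mu).

Let mOm : measurable Om. Proof. exact: open_measurable_rV. Qed.

(** The Hahn set [P] is positive for [mu] and its complement negative, so no competitor inside the
    complement has positive [mu], and none inside [P] has negative [mu]. Thus the two variations are
    mutually singular. *)
Lemma Jordan_upper_variation : exists (p q : {measure set T -> \bar R}) (P : set T),
  [/\ forall E, measurable E -> upper_variation Om mu E = p E,
      forall E, measurable E -> upper_variation Om (fun B => - mu B) E = q E,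
      (p Om < +oo)%E /\ (q Om < +oo)%E &
      [/\ measurable P, p (~` P) = 0%E & q P = 0%E]].
Proof.
have rmu := radon_fin_loc mu_fin; have rmuN := radon_locN rmu.
have [p hp] := upper_variation_measure rmu.
have [q hq] := upper_variation_measure rmuN.
have [nu nuE] := mu_fin.
have [P [M [[mP posP] [mM negM] PM _]]] := Hahn_decomposition nu.
exists p, q, P; split => //.
- rewrite -hp// -hq//; split; apply: upper_variation_finite => //.
    exact: radon_fin_dominated.
  exact/radon_fin_dominated/radon_finN.
- split => //.
  + apply/eqP; rewrite -hp; last exact: measurableC.
    rewrite eq_le upper_variation_ge0// andbT.
    apply: ge_ereal_sup => _ [F [mF cF FP] <-].
    rewrite nuE//; last exact: compactly_inside_subset.
    apply: negM => // x Fx; have : (P `|` M) x by rewrite PM.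
    by case=> // /(FP _ Fx).
  + apply/eqP; rewrite -hq// eq_le upper_variation_ge0// andbT.
    apply: ge_ereal_sup => _ [F [mF cF FP] <-].
    rewrite EFinN nuE//; last exact: compactly_inside_subset.
    by rewrite oppe_le0 posP.
Qed.

Lemma tv_fin_num : tv Om mu Om \is a fin_num.
Proof.
have [m hm] := tv_measure Om_open (radon_fin_loc mu_fin).
rewrite ge0_fin_numE; last by rewrite hm.
by apply: tv_finite => //; exact: radon_fin_dominated.
Qed.

(** On this class both integrals in [signed_integral] are finite, so [fine] splits and linearity
    becomes available. *)
Definition bounded_borel (f : T -> R) :=
  measurable_fun setT f /\ exists M, forall x, `|f x| <= M.

Lemma bounded_borel_integrable (m : {measure set T -> \bar R}) f :
  (m Om < +oo)%E -> bounded_borel f -> m.-integrable Om (EFin \o f).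
Proof. by move=> moo [mf [M hM]]; exact: integrable_of_bounded mf hM. Qed.

Lemma bounded_borelD f g : bounded_borel f -> bounded_borel g ->
  bounded_borel (fun x => f x + g x).
Proof.
move=> [mf [M hM]] [mg [M' hM']]; split; first exact: measurable_funD.
by exists (M + M') => x; apply: le_trans (ler_normD _ _) (lerD _ _).
Qed.

Lemma bounded_borelB f g : bounded_borel f -> bounded_borel g ->
  bounded_borel (fun x => f x - g x).
Proof.
move=> [mf [M hM]] [mg [M' hM']]; split; first exact: measurable_funB.
by exists (M + M') => x; apply: le_trans (ler_normB _ _) (lerD _ _).
Qed.

Lemma bounded_borel_norm f : bounded_borel f -> bounded_borel (fun x => `|f x|).
Proof.
move=> [mf [M hM]]; split; first exact: measurableT_comp.
by exists M => x; rewrite normr_id.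
Qed.

Lemma bounded_borel_cst c : bounded_borel (cst c).
Proof. by split => //; exists `|c|. Qed.

Lemma bounded_borel_indic B : measurable B -> bounded_borel (\1_B : T -> R).
Proof.
move=> mB; split; first exact: measurable_indic.
exists 1 => x; have /andP[? ?] := @indic01 R N B x.
by rewrite ler_norml; lra.
Qed.

Lemma bounded_borel_Cc k f : Cck k Om f -> bounded_borel f.
Proof.
move=> [/Ck_continuous cf [cK _]]; split; first exact: continuous_measurable_rV.
have [M hM] := continuous_compact_bounded cf cK.
exists (Num.max M 0) => x; rewrite le_max.
have [Kx|Kx] := pselect (closure [set y | f y != 0] x); first by rewrite hM.
suff -> : f x = 0 by rewrite normr0 lexx orbT.
apply/eqP; apply: contrapT => /negP h; apply: Kx.
exact: subset_closure.
Qed.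

Lemma signed_integralE (p q : {measure set T -> \bar R}) f :
  (forall E, measurable E -> upper_variation Om mu E = p E) ->
  (forall E, measurable E -> upper_variation Om (fun B => - mu B) E = q E) ->
  (p Om < +oo)%E -> (q Om < +oo)%E -> bounded_borel f ->
  signed_integral Om mu (EFin \o f) =
  \int[p]_(x in Om) f x - \int[q]_(x in Om) f x.
Proof.
move=> hp hq poo qoo bf; rewrite /signed_integral.
rewrite (eq_integral_on_measurable _ _ hp) (eq_integral_on_measurable _ _ hq).
by rewrite fineB//; apply: integrable_fin_num => //; exact: bounded_borel_integrable.
Qed.

Lemma signed_integralB f g : bounded_borel f -> bounded_borel g ->
  signed_integral Om mu (EFin \o (fun x => f x - g x)) =
  signed_integral Om mu (EFin \o f) - signed_integral Om mu (EFin \o g).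
Proof.
move=> bf bg; have [p [q [_ [hp hq [poo qoo] _]]]] := Jordan_upper_variation.
rewrite !(signed_integralE hp hq)//; last exact: bounded_borelB.
by rewrite !RintegralB//; [ring|exact: bounded_borel_integrable..].
Qed.

Lemma fine_tvE (p q : {measure set T -> \bar R}) :
  (forall E, measurable E -> upper_variation Om mu E = p E) ->
  (forall E, measurable E -> upper_variation Om (fun B => - mu B) E = q E) ->
  (p Om < +oo)%E -> (q Om < +oo)%E ->
  fine (tv Om mu Om) = fine (p Om) + fine (q Om).
Proof.
move=> hp hq poo qoo; rewrite tv_upper_variation//; last exact: radon_fin_loc.
by rewrite hp// hq// fineD// ge0_fin_numE.
Qed.

Lemma signed_integral_le f (c : R) : bounded_borel f -> (forall x, `|f x| <= c) ->
  `|signed_integral Om mu (EFin \o f)| <= c * fine (tv Om mu Om).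
Proof.
move=> bf fc; have [p [q [_ [hp hq [poo qoo] _]]]] := Jordan_upper_variation.
rewrite (signed_integralE hp hq)// (fine_tvE hp hq)// mulrDr.
apply: le_trans (ler_normB _ _) _.
have H (m : {measure set T -> \bar R}) : (m Om < +oo)%E ->
    `|\int[m]_(x in Om) f x| <= c * fine (m Om).
  move=> moo; apply: (@le_trans _ _ (\int[m]_(x in Om) `|f x|)).
    by apply: le_normr_Rintegral => //; exact: bounded_borel_integrable.
  rewrite -Rintegral_cst//; apply: le_Rintegral => //.
    by apply: bounded_borel_integrable => //; exact: bounded_borel_norm.
  by apply: bounded_borel_integrable => //; exact: bounded_borel_cst.
by apply: lerD; exact: H.
Qed.

(** The mass is the integral of the sign 1_P - 1_(~P), which is replaced by f - g with [f] and [g]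
    smooth approximations of the two indicators. *)
Lemma tv_le_smooth (e : R) : 0 < e -> exists psi, [/\ Ccinfty Om psi,
  forall x, `|psi x| <= 1 &
  fine (tv Om mu Om) <= signed_integral Om mu (EFin \o psi) + e].
Proof.
move=> e0; have [p [q [P [hp hq [poo qoo] [mP pP qP]]]]] := Jordan_upper_variation.
have mCP : measurable (~` P) by exact: measurableC.
(* Approximating in L^1 of the sum controls the errors under [p] and [q] together. *)
pose m := measure_add p q.
have moo : (m Om < +oo)%E by rewrite /m measure_addE lte_add_pinfty.
have e20 : 0 < e / 2 by rewrite divr_gt0.
have [f [Cf f01 hf]] := measurable_approximable Om_open moo mP e20.
have [g [Cg g01 hg]] := measurable_approximable Om_open moo mCP e20.
pose psi x := f x - g x.
have Cpsi : Ccinfty Om psi.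
  rewrite (_ : psi = f \+ (g \* cst (-1))).
    by apply: CcinftyD => //; apply: CcinftyMr => // k; exact: Ck_cst.
  by apply/funext => x; rewrite /psi/=; ring.
exists psi; split => //.
  move=> x; have /andP[? ?] := f01 x; have /andP[? ?] := g01 x.
  by rewrite /psi ler_norml; lra.
have bf := bounded_borel_Cc (Cf 0%N); have bg := bounded_borel_Cc (Cg 0%N).
have bpsi := bounded_borel_Cc (Cpsi 0%N).
pose a x := `|\1_P x - f x|; pose b x := `|\1_(~` P) x - g x|.
have ba : bounded_borel a.
  by apply: bounded_borel_norm; apply: bounded_borelB => //; exact: bounded_borel_indic.
have bb : bounded_borel b.
  by apply: bounded_borel_norm; apply: bounded_borelB => //; exact: bounded_borel_indic.
have bI B : measurable B -> bounded_borel (\1_B : T -> R) by exact: bounded_borel_indic.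
have int_m h : bounded_borel h -> (forall x, 0 <= h x) ->
    \int[m]_(x in Om) h x = \int[p]_(x in Om) h x + \int[q]_(x in Om) h x.
  move=> bh h0; rewrite /Rintegral integral_measure_add//; last 2 first.
  - exact: bounded_borel_integrable.
  - exact: bounded_borel_integrable.
  by rewrite fineD//; apply: integrable_fin_num => //; exact: bounded_borel_integrable.
have null (n : {measure set T -> \bar R}) B : measurable B -> n B = 0%E ->
    \int[n]_(x in Om) (\1_B x : R) = 0.
  move=> mB nB; rewrite /Rintegral integral_indic// (@subset_measure0 _ _ _ n _ B)//.
  exact: measurableI.
(* [B] is the null set on which the sign is wrong. There h + a + b is only known to be at least -1,
   and adding the indicator of [B] twice restores the bound 1 without changing the integral. *)
have key (n : {measure set T -> \bar R}) (h : T -> R) B : (n Om < +oo)%E -> measurable B ->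
    n B = 0%E -> bounded_borel h ->
    (forall x, 1 <= h x + (a x + b x) + (\1_B x + \1_B x)) ->
    fine (n Om) <= \int[n]_(x in Om) h x +
      (\int[n]_(x in Om) a x + \int[n]_(x in Om) b x).
  move=> noo mB nB bh h1.
  have bab := bounded_borelD ba bb; have bhab := bounded_borelD bh bab.
  have bBB := bounded_borelD (bI B mB) (bI B mB).
  have In k := @bounded_borel_integrable n k noo.
  have bB := bI B mB.
  have <- : \int[n]_(x in Om) (h x + (a x + b x) + (\1_B x + \1_B x)) =
      \int[n]_(x in Om) h x + (\int[n]_(x in Om) a x + \int[n]_(x in Om) b x).
    rewrite (RintegralD mOm (In _ bhab) (In _ bBB)) (RintegralD mOm (In _ bB) (In _ bB)).
    rewrite (RintegralD mOm (In _ bh) (In _ bab)) (RintegralD mOm (In _ ba) (In _ bb)).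
    by rewrite !(null n B mB nB) !addr0.
  rewrite -[fine _]mul1r -Rintegral_cst//; apply: le_Rintegral => //.
  - by apply: In; exact: bounded_borel_cst.
  - by apply: In; exact: bounded_borelD.
have IC x : (\1_(~` P) x : R) = 1 - \1_P x.
  by rewrite !indicE in_setC; case: (x \in P); rewrite ?subrr ?subr0.
have hp1 : fine (p Om) <= \int[p]_(x in Om) psi x +
    (\int[p]_(x in Om) a x + \int[p]_(x in Om) b x).
  apply: (key _ _ (~` P)) => // x; rewrite /psi /a /b IC.
  have := ler_norm (\1_P x - f x); have := ler_norm (- (1 - \1_P x - g x)).
  by rewrite normrN; lra.
have hq1 : fine (q Om) <= \int[q]_(x in Om) (- psi x) +
    (\int[q]_(x in Om) a x + \int[q]_(x in Om) b x).
  apply: (key _ _ P) => //.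
    by have := bounded_borelB (bounded_borel_cst 0) bpsi; under eq_fun do rewrite sub0r.
  move=> x; rewrite /psi /a /b IC.
  have := ler_norm (- (\1_P x - f x)); have := ler_norm (1 - \1_P x - g x).
  by rewrite normrN; lra.
rewrite (fine_tvE hp hq)// (signed_integralE hp hq)//.
have := int_m a ba (fun x => normr_ge0 _); have := int_m b bb (fun x => normr_ge0 _).
have -> : \int[q]_(x in Om) psi x = - \int[q]_(x in Om) (- psi x).
  have := @RintegralB _ _ _ q Om (cst 0) psi mOm; rewrite Rintegral_cst// mul0r sub0r.
  under eq_Rintegral do rewrite sub0r.
  move=> ->; first by rewrite opprK.
    by apply: bounded_borel_integrable => //; exact: bounded_borel_cst.
  exact: bounded_borel_integrable.
by move: hf hg hp1 hq1; rewrite -/(a _) -/(b _) /a /b; lra.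
Qed.

End finite_radon_measure.

(** * Passage to the limit in the pairings, their masses and their measures *)

Theorem theorem4p3 (R : realType) (N : nat) (N_gt0 : (0 < N)%N)
    (Om : set 'rV[R]_N) (Om_open : open Om) (Om_neq0 : Om !=set0)
    (A : set 'rV[R]_N -> 'rV[R]_N) (dA : set 'rV[R]_N -> R)
    (A_DM : DMloc Om A dA)
    (lam : 'rV[R]_N -> R) (lam_borel : measurable_fun Om lam)
    (lam01 : forall x, Om x -> 0 <= lam x <= 1)
    (u_ : nat -> 'rV[R]_N -> R) (u : 'rV[R]_N -> R)
    (Xu_ : forall n, Xloc Om A dA lam (u_ n)) (Xu : Xloc Om A dA lam u)
    (u_cvg : A_lambda_cvg Om A dA lam u_ u) :
  (forall phi : 'rV[R]_N -> R, Cck 1 Om phi ->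
     (fun n => pairing Om A dA lam (u_ n) phi) @ \oo -->
     pairing Om A dA lam u phi) /\
  (BV Om A dA lam u -> (forall n, BV Om A dA lam (u_ n)) ->
   forall (mu : set 'rV[R]_N -> R) (mu_ : nat -> set 'rV[R]_N -> R),
     pairing_is_measure Om A dA lam u mu ->
     (forall n, pairing_is_measure Om A dA lam (u_ n) (mu_ n)) ->
     (tv Om mu Om <= limn_einf (fun n => tv Om (mu_ n) Om))%E /\
     ((ereal_sup (range (fun n => tv Om (mu_ n) Om)) < +oo)%E ->
      weak_cvg_measures Om mu_ mu)).
Proof.
have [rA rdA _] := A_DM.
have cvg1 phi : Cck 1 Om phi ->
    (fun n => pairing Om A dA lam (u_ n) phi) @ \oo --> pairing Om A dA lam u phi.
  exact: pairing_cvg.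
split=> // _ _ mu mu_ [fmu muE] mu_E.
have fmu_ n : radon_fin Om (mu_ n) := (mu_E n).1.
pose t n := fine (tv Om (mu_ n) Om).
have tE n : tv Om (mu_ n) Om = (t n)%:E by rewrite fineK// tv_fin_num.
have cvg2 psi : Ccinfty Om psi ->
    (fun n => signed_integral Om (mu_ n) (EFin \o psi)) @ \oo -->
    signed_integral Om mu (EFin \o psi).
  move=> Cpsi; have := cvg1 _ (Cpsi 1%N); rewrite muE//; apply: cvg_trans.
  by apply: near_eq_cvg; apply: nearW => n; rewrite (mu_E n).2.
split.
  (* Half of [e] is lost in replacing the mass of [mu] by the integral of a smooth [psi], half in
     passing from [mu] to [mu_ k]; the bound is uniform over the tail, hence holds for its
     infimum. *)
  apply/lee_addgt0Pr => e e0; have e20 : 0 < e / 2 by rewrite divr_gt0.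
  have [psi [Cpsi psi1 hpsi]] := tv_le_smooth Om_open fmu e20.
  have bpsi := bounded_borel_Cc (Cpsi 0%N).
  rewrite -leeBlDr// limn_einf_lim; apply: lime_ge; first exact: is_cvg_einfs.
  have /cvgrPdist_lt/(_ _ e20)[n0 _ hn0] := cvg2 _ Cpsi.
  exists n0 => // n /= n0n; apply: le_ereal_inf_tmp => _ [k /= nk <-].
  rewrite tE -(fineK (tv_fin_num Om_open fmu)) -EFinB lee_fin.
  have := hn0 k (leq_trans n0n nk).
  have := signed_integral_le Om_open (fmu_ k) bpsi psi1; rewrite mul1r -/(t k).
  rewrite ler_norml ltr_norml => /andP[_ h1] /andP[_ h2]; move: hpsi h1 h2 => /=; lra.
move=> tbound phi Cphi.
have [M M0 tM] : exists2 M, 0 < M & forall n, t n <= M.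
  exists (`|fine (ereal_sup (range (fun n => tv Om (mu_ n) Om)))| + 1).
    by rewrite ltr_wpDl.
  move=> n; apply: (@le_trans _ _ (fine (ereal_sup (range (fun n => tv Om (mu_ n) Om))))).
    have h : (tv Om (mu_ n) Om <= ereal_sup (range (fun n => tv Om (mu_ n) Om)))%E.
      by apply: ereal_sup_ubound; exists n.
    rewrite /t fine_le ?tv_fin_num// fin_numElt tbound andbT.
    by apply: lt_le_trans h; rewrite tE ltNyr.
  by apply: le_trans (ler_norm _) _; rewrite lerDl.
pose t0 := fine (tv Om mu Om).
have t0_ge0 : 0 <= t0.
  have := signed_integral_le Om_open fmu (bounded_borel_cst 0) (c := 1).
  by rewrite mul1r => h; apply: le_trans (h _) => // x; rewrite normr0.
apply/cvgrPdist_lt => e e0.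
(* Replacing [phi] by [psi] costs at most d t0 under [mu] and d M under [mu_ n], together strictly
   less than e/2 thanks to the summand 1; convergence on [psi] costs the other half. *)
pose d := e / (2 * (M + t0 + 1)).
have d0 : 0 < d by rewrite divr_gt0// mulr_gt0// ltr_wpDl// addr_ge0// ltW.
have [psi Cpsi hpsi] := Cc_uniform_approx Om_open Cphi d0.
have bphi := bounded_borel_Cc Cphi; have bpsi := bounded_borel_Cc (Cpsi 0%N).
have e20 : 0 < e / 2 by rewrite divr_gt0.
have /cvgrPdist_lt/(_ _ e20)[n0 _ hn0] := cvg2 _ Cpsi.
exists n0 => // n /= n0n.
have bd := bounded_borelB bphi bpsi.
have := signed_integral_le Om_open (fmu_ n) bd hpsi.
have := signed_integral_le Om_open fmu bd hpsi.
rewrite !signed_integralB// -/(t n) -/t0.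
have := hn0 n n0n; rewrite /=.
set x := signed_integral _ _ _; set y := signed_integral _ _ _.
set z := signed_integral _ _ _; set w := signed_integral _ _ _.
have dt : d * t0 + d * t n < e / 2.
  apply: (@le_lt_trans _ _ (d * (M + t0))).
    by rewrite -mulrDr ler_pM2l// addrC lerD2r.
  have -> : e / 2 = d * (M + t0 + 1).
    by rewrite /d; field; rewrite gt_eqF// ltr_wpDl// addr_ge0// ltW.
  by rewrite ltr_pM2l// ltrDl.
rewrite !ltr_norml !ler_norml; lra.
Qed.
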